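(* There is an algorithm with the following property. Let an AWET instance be given, together with fixed total orders $\prec_E$ and $\prec_L$ on the jobs refining, respectively, nondecreasing early ratios $r_j$ and nondecreasing tardiness ratios $s_j$. If the resulting ratio permutation $\pi$ is separable (equivalently, if $\pi$ has a separating tree), then for every rational $\varepsilon>0$ the algorithm returns a feasible schedule of cost at most $$(1+\varepsilon)\,\mathrm{OPT},$$ and its running time is polynomial in the binary input length and $1/\varepsilon$. That is, AWET with separable ratio permutation admits an FPTAS.
   Context: An instance of AWET consists of jobs $J$, $|J|=n\ge1$; job $j$ has a positive integer processing time $p_j$, a positive integer earliness weight $w_j^E$, and a positive integer tardiness weight $w_j^L$. The jobs are processed nonpreemptively on one machine available from time $0$: a schedule assigns each job a real start time $S_j\ge 0$ so that the intervals $[S_j,S_j+p_j)$ are pairwise disjoint; $C_j=S_j+p_j$. The common due date is $d=\sum_{j\in J}p_j$. The cost to be minimized is $\sum_{j\in J}\bigl(w_j^E (d-C_j)^+ + w_j^L (C_j-d)^+\bigr)$ with $x^+=\max\{x,0\}$, and $\mathrm{OPT}$ is its minimum. Put $r_j=w_j^E/p_j$, $s_j=w_j^L/p_j$. Ratio permutation: $\prec_E$ is a total order on $J$ with $r_i<r_j\Rightarrow i\prec_E j$, and $\prec_L$ is a total order with $s_i<s_j\Rightarrow i\prec_L j$ (ties broken arbitrarily). List the jobs as $j_1\prec_E\cdots\prec_E j_n$; $\pi(k)$ is the position of $j_k$ in the order $\prec_L$. Separating tree of a permutation $\pi$ of $\{1,\dots,n\}$: a rooted plane binary tree whose leaves,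 from left to right, are labeled $\pi(1),\dots,\pi(n)$, such that for every node the labels of the leaves below it form a set of consecutive integers, and every internal node, with left child $A$ and right child $B$, is either positive (direct: every label below $A$ is smaller than every label below $B$) or negative (skew: every label below $A$ is larger than every label below $B$). A permutation is separable if it has a separating tree; equivalently, if it can be built recursively from the one-element permutation by direct sums and skew sums. *)

(* Defs.v *)
From mathcomp Require Import all_boot all_order all_algebra.
From mathcomp Require Import reals.

Set Implicit Arguments.
Unset Strict Implicit.
Unset Printing Implicit Defensive.

Import Order.TTheory GRing.Theory Num.Theory.

Local Open Scope ring_scope.

(** * Model of computation

    A Turing-complete language of programs acting on binary trees whose leaves
    are natural numbers written in binary.  Every step is charged at least the
    full length of the data it reads and writes (nothing is shared or passed by
    reference), and each basic operation is computable in polynomial time on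
    Turing machines, so a running time bound in this model is, up to a
    polynomial, a bit-complexity bound. *)

Inductive value := VNum of nat | VPair of value & value.

(* [trunc_log 2 n + 1] is the number of binary digits of [n] (and 1 for 0). *)
Fixpoint value_len (v : value) : nat :=
  match v with
  | VNum n => (trunc_log 2 n).+1
  | VPair a b => (value_len a + value_len b).+1%N
  end.

Inductive op := OConst of nat | OFst | OSnd | OIsPair | OAdd | OSub | OMul | ODiv.

(* [OSub] is truncated subtraction and [ODiv] Euclidean division with x / 0 = 0;
   operations applied to data of the wrong shape return 0. *)
Definition op_sem (o : op) (v : value) : value :=
  match o, v with
  | OConst k, _ => VNum k
  | OFst, VPair a _ => a
  | OSnd, VPair _ b => b
  | OIsPair, VPair _ _ => VNum 1
  | OAdd, VPair (VNum a) (VNum b) => VNum (a + b)%N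
  | OSub, VPair (VNum a) (VNum b) => VNum (a - b)%N
  | OMul, VPair (VNum a) (VNum b) => VNum (a * b)%N
  | ODiv, VPair (VNum a) (VNum b) => VNum (a %/ b)%N
  | _, _ => VNum 0
  end.

Inductive prog :=
| PId
| POp of op
| PSeq of prog & prog
| PFork of prog & prog
| PIf of prog & prog & prog
| PWhile of prog & prog.

(* [exec p x y t]: on input [x], program [p] halts with output [y] in time [t].
   A test succeeds when its result differs from [VNum 0]. *)
Inductive exec : prog -> value -> value -> nat -> Prop :=
| exec_id x : exec PId x x (value_len x)
| exec_op o x : exec (POp o) x (op_sem o x) (value_len x + value_len (op_sem o x))
| exec_seq f g x y z s t :
    exec f x y s -> exec g y z t -> exec (PSeq f g) x z (value_len x + s + t)
| exec_fork f g x y z s t :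
    exec f x y s -> exec g x z t ->
    exec (PFork f g) x (VPair y z) (value_len x + s + t + value_len (VPair y z))
| exec_if_true c f g x b y s t :
    exec c x b s -> b <> VNum 0 -> exec f x y t ->
    exec (PIf c f g) x y (value_len x + s + t)
| exec_if_false c f g x y s t :
    exec c x (VNum 0) s -> exec g x y t ->
    exec (PIf c f g) x y (value_len x + s + t)
| exec_while_stop c f x s :
    exec c x (VNum 0) s -> exec (PWhile c f) x x (value_len x + s)
| exec_while_step c f x b y z s t u :
    exec c x b s -> b <> VNum 0 -> exec f x y t -> exec (PWhile c f) y z u ->
    exec (PWhile c f) x z (value_len x + s + t + u).

Lemma exec_deterministic p x y t y' t' :
  exec p x y t -> exec p x y' t' -> y = y' /\ t = t'.
Proof.
move=> H; elim: H y' t' => {p x y t}; intros;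
  match goal with H : exec _ _ ?y' ?t' |- _ = ?y' /\ _ = ?t' =>
    inversion H; subst end;
  by repeat match goal with
  | IH : forall y' t', exec ?p ?x y' t' -> _, H : exec ?p ?x _ _ |- _ =>
      case: (IH _ _ H) => ? ?; clear H; subst
  end.
Qed.

(** * Instances, schedules, cost *)

Record awet := AWET {
  njobs : nat;
  ptime : 'I_njobs -> nat;
  wE : 'I_njobs -> nat;
  wL : 'I_njobs -> nat;
  njobs_gt0 : (0 < njobs)%N;
  ptime_gt0 : forall j, (0 < ptime j)%N;
  wE_gt0 : forall j, (0 < wE j)%N;
  wL_gt0 : forall j, (0 < wL j)%N
}.

Definition due_date (I : awet) : nat := (\sum_(j < njobs I) ptime j)%N.

Definition feasible (R : realType) (I : awet) (S : 'I_(njobs I) -> R) : Prop :=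
  (forall j, 0 <= S j) /\
  (forall i j x, i != j ->
     x \in `[S i, S i + (ptime i)%:R[ -> x \notin `[S j, S j + (ptime j)%:R[).

Definition cost (R : realType) (I : awet) (S : 'I_(njobs I) -> R) : R :=
  let d : R := (due_date I)%:R in
  let C j : R := S j + (ptime j)%:R in
  \sum_j ((wE j)%:R * Num.max (d - C j) 0 + (wL j)%:R * Num.max (C j - d) 0).

Definition is_OPT (R : realType) (I : awet) (v : R) : Prop :=
  (exists2 S : 'I_(njobs I) -> R, feasible S & cost S = v) /\
  (forall S : 'I_(njobs I) -> R, feasible S -> v <= cost S).

Definition early_ratio (I : awet) (j : 'I_(njobs I)) : rat :=
  (wE j)%:R / (ptime j)%:R.

Definition tardy_ratio (I : awet) (j : 'I_(njobs I)) : rat :=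
  (wL j)%:R / (ptime j)%:R.

(** * Ratio permutation and separating trees *)

Definition strict_total_order (T : eqType) (lt : rel T) : Prop :=
  [/\ irreflexive lt, transitive lt & forall i j, i != j -> lt i j || lt j i].

Definition listing n (lt : rel 'I_n) : seq 'I_n :=
  sort (fun i j => (i == j) || lt i j) (enum 'I_n).

(* The word pi(1) ... pi(n), with labels in {1, ..., n}. *)
Definition ratio_perm n (ltE ltL : rel 'I_n) : seq nat :=
  [seq (index j (listing ltL)).+1 | j <- listing ltE].

Inductive btree := Leaf of nat | Node of btree & btree.

Fixpoint leaves (T : btree) : seq nat :=
  match T with
  | Leaf l => [:: l]
  | Node A B => leaves A ++ leaves B
  end.

Definition consecutive (s : seq nat) : Prop :=
  exists a, perm_eq s (iota a (size s)).

Definition positive (A B : btree) : Prop :=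
  forall x y, x \in leaves A -> y \in leaves B -> (x < y)%N.

Definition negative (A B : btree) : Prop :=
  forall x y, x \in leaves A -> y \in leaves B -> (y < x)%N.

Fixpoint nodes_ok (T : btree) : Prop :=
  consecutive (leaves T) /\
  match T with
  | Leaf _ => True
  | Node A B => [/\ positive A B \/ negative A B, nodes_ok A & nodes_ok B]
  end.

Definition separating_tree (T : btree) (w : seq nat) : Prop :=
  leaves T = w /\ nodes_ok T.

Definition separable (w : seq nat) : Prop := exists T, separating_tree T w.

(** * Encoding of inputs and outputs *)

Definition enc_seq (s : seq value) : value := foldr VPair (VNum 0) s.

(* Reduced fraction; used for nonnegative rationals only. *)
Definition enc_rat (q : rat) : value := VPair (VNum `|numq q|) (VNum `|denq q|).

Definition enc_jobs (I : awet) : value :=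
  enc_seq [seq VPair (VNum (ptime j)) (VPair (VNum (wE j)) (VNum (wL j)))
          | j <- enum 'I_(njobs I)].

Definition enc_order n (lt : rel 'I_n) : value :=
  enc_seq [seq VNum (nat_of_ord j) | j <- listing lt].

Definition enc_input (I : awet) (ltE ltL : rel 'I_(njobs I)) (eps : rat) : value :=
  VPair (enc_rat eps) (VPair (enc_jobs I) (VPair (enc_order ltE) (enc_order ltL))).

Definition enc_schedule n (S : 'I_n -> rat) : value :=
  enc_seq [seq enc_rat (S j) | j <- enum 'I_n].

(* Main.v *)
Require Import Defs.
From mathcomp Require Import all_boot all_order all_algebra.
From mathcomp Require Import reals zify ring lra.

(**
  In an optimal schedule no idle time surrounds the due date d, one job ends at
  d, and on either side of d the jobs lie by decreasing ratio away from d; so the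
  cost is a sum over pairs of jobs lying on the same side, and OPT is the minimum
  of this sum over all partitions into early and tardy jobs.  At a node of the
  separating tree with children A and B, the cost of the cross pairs is
  wE(early A) p(early B) plus wL(tardy A) p(tardy B) at a direct node or
  wL(tardy B) p(tardy A) at a skew node.  Hence five sums determine how a partial
  partition behaves, everything is monotone in them, and one may discard a
  partial partition when a retained one is at most 1 + 1/K times larger in all
  five: the loss is a factor (1 + 1/K)^(2n), while only polynomially many
  (in K and the number of digits) partial partitions survive.

  The tree need not be computed: reading the permutation from left to right and
  merging the two topmost blocks of a stack whenever their labels form an
  interval succeeds, because a partition of a separable permutation into
  intervals always has two neighbours whose union is an interval.

  For the running time, an integer of size about 1/eps is first written in
  unary, so that everything else is polynomial in the length of the data.
*)

Set Implicit Arguments.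
Unset Strict Implicit.
Unset Printing Implicit Defensive.

Import Order.TTheory GRing.Theory Num.Theory.

(** * Polynomial time *)

(** Separability is used only through pairs of blocks: when two neighbouring blocks have labels
    forming disjoint intervals with an interval as union, all their cross pairs compare alike in
    both orders, so the cross cost is bilinear in the block sums. Any such merge is as good as one
    at a node of the given tree; the tree serves only to show that the parser cannot get stuck.
    Because of these products the cost is followed with twice the exponent of the sums, which is the
    origin of the 2 in 2n.

    Two obstacles shape the rest. A schedule may process a job across d and then defines no
    partition; it is compared with a mixture of two partitions, that job early or tardy, in the
    proportion in which d cuts it. Conversely every partition is realizable because d is the total
    processing time, so any set of early jobs fits before d.

    Polynomial time is closed under composition but not under iteration, so each loop needs a bound
    on all its intermediate data in terms of its input. For the parser this bound is a pigeonhole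
    count of retained partial partitions. *)

Class data (A : Type) := Data { enc : A -> value; dflt : A }.

#[global] Instance data_nat : data nat := Data VNum 0.
(** The coercion yields 1 and 0, so a computed boolean can be tested directly by [PIf] and
    [PWhile]. *)
#[global] Instance data_bool : data bool := Data (fun b : bool => VNum b) false.
#[global] Instance data_prod A B (dA : data A) (dB : data B) : data (A * B) :=
  Data (fun x => VPair (enc x.1) (enc x.2)) (dflt, dflt).
#[global] Instance data_seq A (dA : data A) : data (seq A) :=
  Data (fun s => enc_seq (map enc s)) [::].

Definition len {A} {dA : data A} (a : A) : nat := value_len (enc a).

(** For a positive size the base is at least 2, so the exponent alone absorbs constant factors and
    lower terms. *)
Definition polyb A (sz : A -> nat) (T : A -> nat) :=
  exists c, forall a, T a <= (sz a).+1 ^ c.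

Definition computes {A B} {dA : data A} {dB : data B} (p : prog) (f : A -> B)
    (T : A -> nat) :=
  forall a, exists2 t, exec p (enc a) (enc (f a)) t & t <= T a.

(** The size is a parameter for the sake of one loop, whose number of rounds is polynomial in the
    value, not the length, of a counter. *)
Definition polytime_wrt {A B} {dA : data A} {dB : data B} (sz : A -> nat)
    (f : A -> B) :=
  exists p T, polyb sz T /\ computes p f T.

Notation polytime f := (polytime_wrt len f).

Lemma value_len_gt0 v : 0 < value_len v.
Proof. by case: v. Qed.

Lemma exec_len p x y t : exec p x y t -> value_len y <= t.
Proof. by elim=> *; lia. Qed.

Lemma exec_len_in p x y t : exec p x y t -> value_len x <= t.
Proof. by elim=> *; lia. Qed.

Section PolyBounds.
Variables (A : Type) (sz : A -> nat).
Implicit Types T U : A -> nat.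
Hypothesis sz_gt0 : forall a, 0 < sz a.

Lemma polyb_le T U : (forall a, T a <= U a) -> polyb sz U -> polyb sz T.
Proof. by move=> TU [c Uc]; exists c => a; apply: leq_trans (TU a) (Uc a). Qed.

Lemma polyb_const n : polyb sz (fun=> n).
Proof.
exists n => a; apply: leq_trans (ltnW (ltn_expl n (isT : 1 < 2))) _.
by case: n => [|n] //; rewrite leq_exp2r // ltnS.
Qed.

Lemma polyb_id : polyb sz sz.
Proof. by exists 1 => a; rewrite expn1. Qed.

Lemma polyb_add T U : polyb sz T -> polyb sz U -> polyb sz (fun a => T a + U a).
Proof.
move=> [c Tc] [d Ud]; exists (c + d).+1 => a.
have s2 : 1 < (sz a).+1 by rewrite ltnS.
rewrite expnS expnD; move: (Tc a) (Ud a) (expn_gt0 (sz a).+1 c) (expn_gt0 (sz a).+1 d).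
by rewrite /=; move: (_ ^ c) (_ ^ d) => x y ? ?; nia.
Qed.

Lemma polyb_mul T U : polyb sz T -> polyb sz U -> polyb sz (fun a => T a * U a).
Proof.
move=> [c Tc] [d Ud]; exists (c + d) => a.
by rewrite expnD leq_mul.
Qed.

Lemma polyb_exp T c : polyb sz T -> polyb sz (fun a => T a ^ c).
Proof.
move=> [d Td]; exists (d * c) => a; rewrite expnM.
by case: c => [|c]; rewrite ?expn0 // leq_exp2r.
Qed.

Lemma polyb_S T : polyb sz T -> polyb sz (fun a => (T a).+1).
Proof.
move=> /polyb_add /(_ (polyb_const 1)); apply: polyb_le => a; by rewrite addn1.
Qed.

End PolyBounds.

Lemma polyb_comp A B (sA : A -> nat) (sB : B -> nat) (f : A -> B) (T : B -> nat) :
  (forall a, 0 < sA a) -> polyb sB T -> polyb sA (sB \o f) -> polyb sA (T \o f).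
Proof.
move=> s0 [c Tc] /(polyb_S s0) /(polyb_exp c); apply: polyb_le => a.
exact: Tc.
Qed.

Lemma len_gt0 {A} {dA : data A} (a : A) : 0 < len a.
Proof. exact: value_len_gt0. Qed.
#[global] Hint Resolve len_gt0 : core.

Ltac polyb :=
  repeat first [ assumption | apply: polyb_const; done | apply: polyb_id
    | apply: polyb_S; [done|] | apply: polyb_add; [done| |]
    | apply: polyb_mul | apply: polyb_exp ].

(** Since a program is charged for its output, a time bound is also an output bound; composition
    rests on this. *)
Lemma polyb_len {A B} {dA : data A} {dB : data B} (f : A -> B) (sz : A -> nat) :
  polytime_wrt sz f -> polyb sz (fun a => len (f a)).
Proof.
move=> [p [T [Tb pT]]]; apply: polyb_le Tb => a.
by case: (pT a) => t /exec_len; apply: leq_trans.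
Qed.

Section Basic.
Context {A B C : Type} {dA : data A} {dB : data B} {dC : data C}.

Lemma polytime_ext (f g : A -> B) sz : f =1 g -> polytime_wrt sz f -> polytime_wrt sz g.
Proof.
move=> fg [p [T [Tb pT]]]; exists p, T; split=> // a; case: (pT a) => t.
by rewrite fg; exists t.
Qed.

Lemma polytime_comp (f : A -> B) (g : B -> C) :
  polytime f -> polytime g -> polytime (fun a => g (f a)).
Proof.
move=> ptf [q [U [Ub qU]]]; have lf := polyb_len ptf.
case: ptf => p [T [Tb pT]].
exists (PSeq p q), (fun a => len a + T a + U (f a)); split.
  polyb; exact: (@polyb_comp _ _ _ len f U).
move=> a; case: (pT a) => s es ls; case: (qU (f a)) => t et lt.
eexists; first exact: exec_seq es et.
by rewrite /len; lia.
Qed.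

Lemma polytime_pair (f : A -> B) (g : A -> C) :
  polytime f -> polytime g -> polytime (fun a => (f a, g a)).
Proof.
move=> ptf ptg; have lf := polyb_len ptf; have lg := polyb_len ptg.
case: ptf => p [T [Tb pT]]; case: ptg => q [U [Ub qU]].
exists (PFork p q), (fun a => len a + T a + U a + (len (f a) + len (g a)).+1); split.
  by polyb.
move=> a; case: (pT a) => s es ls; case: (qU a) => t et lt.
eexists; first exact: exec_fork es et.
by rewrite /len /=; lia.
Qed.

Lemma polytime_if (b : A -> bool) (f g : A -> B) :
  polytime b -> polytime f -> polytime g ->
  polytime (fun a => if b a then f a else g a).
Proof.
move=> [r [V [Vb rV]]] [p [T [Tb pT]]] [q [U [Ub qU]]].
exists (PIf r p q), (fun a => len a + V a + (T a + U a)); split; first by polyb.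
move=> a; case: (pT a) => s es ls; case: (qU a) => t et lt.
case: (rV a) => u; case: (b a) => eu lu.
  by eexists; [apply: exec_if_true eu _ es|rewrite /len; lia].
by eexists; [apply: exec_if_false eu et|rewrite /len; lia].
Qed.

Lemma polytime_id : polytime (@id A).
Proof.
exists PId, len; split; first by polyb.
by move=> a; exists (len a) => //; constructor.
Qed.

Lemma polytime_op (o : op) (f : A -> B) :
  (forall a, op_sem o (enc a) = enc (f a)) -> polyb len (fun a => len (f a)) ->
  polytime f.
Proof.
move=> of_ lf; exists (POp o), (fun a => len a + len (f a)); split; first by polyb.
move=> a; exists (len a + len (f a)) => //.
by rewrite /len -of_; apply: exec_op.
Qed.

Lemma polytime_const (b : B) : polytime (fun _ : A => b).
Proof.
have [p [T [Tb pT]]] : exists p T, polyb len T /\ forall a : A,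
    exists2 t, exec p (enc a) (enc b) t & t <= T a.
move: (enc b) => w; elim: w => [n|u [p [T [Tb pT]]] v [q [U [Ub qU]]]].
    exists (POp (OConst n)), (fun a => len a + value_len (VNum n)); split.
      by polyb.
    by move=> a; eexists; [constructor|].
  exists (PFork p q), (fun a => len a + T a + U a + value_len (VPair u v)).
  split; first by polyb.
  move=> a; case: (pT a) => s es ls; case: (qU a) => t et lt.
  eexists; first exact: exec_fork es et.
  by rewrite /len; lia.
by exists p, T.
Qed.

End Basic.

Section Derived.
Context {X A B : Type} {dX : data X} {dA : data A} {dB : data B}.

Lemma polytime_fst (f : X -> A * B) : polytime f -> polytime (fun x => (f x).1).
Proof.
move=> ptf; apply: (polytime_comp ptf); apply: (@polytime_op _ _ _ _ OFst) => //.
by apply: polyb_le (polyb_id _) => a; rewrite /len /=; lia.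
Qed.

Lemma polytime_snd (f : X -> A * B) : polytime f -> polytime (fun x => (f x).2).
Proof.
move=> ptf; apply: (polytime_comp ptf); apply: (@polytime_op _ _ _ _ OSnd) => //.
by apply: polyb_le (polyb_id _) => a; rewrite /len /=; lia.
Qed.

Lemma len_cons (a : A) s : len (a :: s) = (len a + len s).+1.
Proof. by []. Qed.

Lemma len_pair (a : A) (b : B) : len (a, b) = (len a + len b).+1.
Proof. by []. Qed.

Lemma polytime_cons (f : X -> A) (g : X -> seq A) :
  polytime f -> polytime g -> polytime (fun x => f x :: g x).
Proof.
move=> ptf ptg; case: (polytime_pair ptf ptg) => p [T [Tb pT]].
by exists p, T.
Qed.

Lemma polytime_nilp (f : X -> seq A) : polytime f -> polytime (fun x => nilp (f x)).
Proof.
(* [OIsPair] recognizes the nonempty lists, hence the negated test with exchanged branches. *)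
move=> ptf; apply: (polytime_ext (f := fun x => if ~~ nilp (f x) then false else true)).
  by move=> x; case: nilp.
apply: polytime_if; try exact: polytime_const.
apply: (polytime_comp ptf (g := fun s => ~~ nilp s)).
apply: (@polytime_op _ _ _ _ OIsPair); first by case.
by apply: polyb_le (polyb_const _ 1) => //; case.
Qed.

Lemma polytime_behead (f : X -> seq A) :
  polytime f -> polytime (fun x => behead (f x)).
Proof.
(* On the empty list [OSnd] returns 0, which is again the empty list. *)
move=> ptf; apply: (polytime_comp ptf); apply: (@polytime_op _ _ _ _ OSnd).
  by case.
by apply: polyb_le (polyb_id _); case=> [|a s] //; rewrite len_cons /=; lia.
Qed.

Lemma polytime_head (f : X -> seq A) :
  polytime f -> polytime (fun x => head dflt (f x)).
Proof.
move=> ptf; apply: (polytime_comp ptf (g := fun s => head dflt s)).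
have [q [U [Ub qU]]] : polytime (fun _ : seq A => dflt : A) by exact: polytime_const.
exists (PIf (POp OIsPair) (POp OFst) q), 
  (fun a => len a + (len a + value_len (VNum 1)) + (len a + len a + U a)); split.
  by polyb.
case=> [|a s].
  case: (qU [::]) => t et lt; eexists; first by apply: exec_if_false et; constructor.
  by rewrite /len /=; lia.
eexists; first by apply: exec_if_true; [constructor| |constructor].
by rewrite /= /len /=; lia.
Qed.

End Derived.

Section Arith.
Context {X : Type} {dX : data X}.
Implicit Types f g : X -> nat.

Lemma len_nat_le (n : nat) : len n <= n.+1.
Proof.
rewrite /len /= ltnS; case: n => [|n] //.
have /andP[h _] := trunc_log_bounds (isT : 1 < 2) (isT : 0 < n.+1).
exact: leq_trans (ltnW (ltn_expl _ (isT : 1 < 2))) h.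
Qed.

Lemma len_nat_exp (n e : nat) : n < 2 ^ e.+1 -> len n <= e.+1.
Proof.
case: n => [|n] h; first by rewrite /len /=.
rewrite /len /= -(ltn_exp2l _ _ (isT : 1 < 2)); apply: leq_ltn_trans h.
by have /andP[] := trunc_log_bounds (isT : 1 < 2) (isT : 0 < n.+1).
Qed.

Lemma len_mono (m n : nat) : m <= n -> len m <= len n.
Proof. by move=> mn; rewrite /len /= ltnS leq_trunc_log. Qed.

Lemma len_add (m n : nat) : len (m + n) <= len m + len n.
Proof.
have [->|m0] := posnP m; first by rewrite add0n leq_addl.
have [->|n0] := posnP n; first by rewrite addn0 leq_addr.
have hm := trunc_log_ltn m (isT : 1 < 2).
have hn := trunc_log_ltn n (isT : 1 < 2).
rewrite {2 3}/len /= addSn; apply: len_nat_exp.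
rewrite -(addSn (trunc_log 2 m)) expnD.
have e2 k : 1 < 2 ^ k.+1 by rewrite -{1}(expn0 2) ltn_exp2l.
move: (e2 (trunc_log 2 m)) (e2 (trunc_log 2 n)) hm hn.
by move: (2 ^ _) (2 ^ _) => u v; nia.
Qed.

Lemma len_mul (m n : nat) : len (m * n) <= len m + len n.
Proof.
have hm := trunc_log_ltn m (isT : 1 < 2).
have hn := trunc_log_ltn n (isT : 1 < 2).
rewrite {2 3}/len /= addSn; apply: len_nat_exp.
rewrite -(addSn (trunc_log 2 m)) expnD.
by apply: ltn_mul.
Qed.

Let binop o (h : nat -> nat -> nat) f g :
  (forall m n, op_sem o (VPair (VNum m) (VNum n)) = VNum (h m n)) ->
  (forall m n, len (h m n) <= len m + len n) ->
  polytime f -> polytime g -> polytime (fun x => h (f x) (g x)).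
Proof.
move=> oh lh ptf ptg.
apply: (polytime_comp (polytime_pair ptf ptg) (g := fun y => h y.1 y.2)).
apply: (@polytime_op _ _ _ _ o) => [[m n]|]; first exact: oh.
apply: polyb_le (polyb_id _) => -[m n] /=; rewrite len_pair.
exact: leq_trans (lh m n) (leqnSn _).
Qed.

Lemma polytime_add f g : polytime f -> polytime g -> polytime (fun x => f x + g x).
Proof. by apply: (@binop OAdd) => // m n; apply: len_add. Qed.

Lemma polytime_mul f g : polytime f -> polytime g -> polytime (fun x => f x * g x).
Proof. by apply: (@binop OMul) => // m n; apply: len_mul. Qed.

Lemma polytime_sub f g : polytime f -> polytime g -> polytime (fun x => f x - g x).
Proof.
apply: (@binop OSub) => // m n; apply: leq_trans (leq_addr _ _).
exact/len_mono/leq_subr.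
Qed.

Lemma polytime_div f g : polytime f -> polytime g -> polytime (fun x => f x %/ g x).
Proof.
apply: (@binop ODiv) => // m n; apply: leq_trans (leq_addr _ _).
exact/len_mono/leq_div.
Qed.

Lemma polytime_eq0 f : polytime f -> polytime (fun x => f x == 0).
Proof.
move=> [p [T [Tb pT]]].
have [p1 [T1 [Tb1 pT1]]] : polytime (fun _ : X => true) by exact: polytime_const.
have [p2 [T2 [Tb2 pT2]]] : polytime (fun _ : X => false) by exact: polytime_const.
exists (PIf p p2 p1), (fun x => len x + T x + (T1 x + T2 x)); split; first by polyb.
move=> x; case: (pT x) => t; case: (pT1 x) => t1 e1 l1; case: (pT2 x) => t2 e2 l2.
case: (f x) => [|n] et lt.
  by eexists; [apply: exec_if_false et e1|rewrite /len; lia].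
by eexists; [apply: exec_if_true et _ e2|rewrite /len; lia].
Qed.

Lemma polytime_leq f g : polytime f -> polytime g -> polytime (fun x => f x <= g x).
Proof. by move=> ptf ptg; apply: polytime_eq0; apply: polytime_sub. Qed.

Lemma polytime_ltn f g : polytime f -> polytime g -> polytime (fun x => f x < g x).
Proof.
move=> ptf ptg; apply: (polytime_ext (f := fun x => f x + 1 <= g x)).
  by move=> x; rewrite addn1.
by apply: polytime_leq => //; apply: polytime_add => //; exact: polytime_const.
Qed.

Lemma polytime_andb (a b : X -> bool) :
  polytime a -> polytime b -> polytime (fun x => a x && b x).
Proof. by move=> pa pb; apply: polytime_if => //; apply: polytime_const. Qed.

Lemma polytime_orb (a b : X -> bool) :
  polytime a -> polytime b -> polytime (fun x => a x || b x).
Proof. by move=> pa pb; apply: polytime_if => //; apply: polytime_const. Qed.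

Lemma polytime_negb (a : X -> bool) : polytime a -> polytime (fun x => ~~ a x).
Proof. by move=> pa; apply: polytime_if => //; apply: polytime_const. Qed.

Lemma polytime_eqn f g : polytime f -> polytime g -> polytime (fun x => f x == g x).
Proof.
move=> ptf ptg; apply: (polytime_ext (f := fun x => (f x <= g x) && (g x <= f x))).
  by move=> x; rewrite eqn_leq.
by apply: polytime_andb; apply: polytime_leq.
Qed.

End Arith.

Lemma leq_exp2 m n k : m <= n -> m ^ k <= n ^ k.
Proof. by case: k => [|k] // mn; rewrite leq_exp2r. Qed.

(** * Loops with an a priori bound on the intermediate data *)

Section Loops.

Lemma exec_while c f (y : nat -> value) n L :
  (forall k, k < n -> exists b s, [/\ exec c (y k) b s, b <> VNum 0 & s <= L]) ->
  (exists2 s, exec c (y n) (VNum 0) s & s <= L) ->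
  (forall k, k < n -> exists2 t, exec f (y k) (y k.+1) t & t <= L) ->
  exists2 t, exec (PWhile c f) (y 0) (y n) t & t <= n.+1 * (3 * L).
Proof.
elim: n y => [|n IH] y cy [s es ls] fy.
  by eexists; [apply: exec_while_stop es|have := exec_len_in es; lia].
have [||k kn|t et lt] := IH (fun k => y k.+1).
- by move=> k kn; apply: cy.
- by exists s.
- exact: fy.
have [b [u [eu bn lu]]] := cy 0 isT; have [v ev lv] := fy 0 isT.
eexists; first exact: exec_while_step eu bn ev et.
by have := exec_len_in eu; lia.
Qed.

(** A body polynomial in its own input may still let the data explode over many rounds; therefore
    [M] bounds every iterate in terms of the initial value. *)
Lemma polytime_while A (dA : data A) (sz : A -> nat) (c : A -> bool) (f : A -> A)
    (n M : A -> nat) :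
  (forall a, 0 < sz a) -> polytime c -> polytime f ->
  (forall a k, k < n a -> c (iter k f a)) -> (forall a, ~~ c (iter (n a) f a)) ->
  polyb sz n -> polyb sz M -> (forall a k, k <= n a -> len (iter k f a) <= M a) ->
  polytime_wrt sz (fun a => iter (n a) f a).
Proof.
move=> sz0 [p [T [[d Td] pT]]] [q [U [[e Ue] qU]]] ct cf nb Mb lM.
pose L a := (M a).+1 ^ d + (M a).+1 ^ e.
exists (PWhile p q), (fun a => (n a).+1 * (3 * L a)); split.
  rewrite /L; apply: polyb_mul; first by polyb.
  by apply: polyb_mul; polyb.
move=> a.
have TL k : k <= n a -> T (iter k f a) <= L a.
  move=> kn; apply: leq_trans (Td _) _; apply: leq_trans (leq_addr _ _).
  by apply: leq_exp2; rewrite ltnS lM.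
have UL k : k <= n a -> U (iter k f a) <= L a.
  move=> kn; apply: leq_trans (Ue _) _; apply: leq_trans (leq_addl _ _).
  by apply: leq_exp2; rewrite ltnS lM.
apply: (@exec_while p q (fun k => enc (iter k f a)) (n a) (L a)).
- move=> k kn; have [s es ls] := pT (iter k f a).
  rewrite ct // in es; exists (VNum 1), s; split=> //.
  exact: leq_trans ls (TL _ (ltnW kn)).
- have [s es ls] := pT (iter (n a) f a).
  rewrite (negbTE (cf a)) in es; exists s => //.
  exact: leq_trans ls (TL _ (leqnn _)).
- move=> k kn; have [s es ls] := qU (iter k f a).
  by exists s => //; exact: leq_trans ls (UL _ (ltnW kn)).
Qed.

Context {X A B : Type} {dX : data X} {dA : data A} {dB : data B}.

Lemma polytime_foldl (z : X -> A) (s : X -> seq B) (g : X -> A -> B -> A)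
    (M : X -> nat) :
  polytime z -> polytime s ->
  polytime (fun y : X * A * B => g y.1.1 y.1.2 y.2) ->
  polyb len M ->
  (forall x s1 s2, s x = s1 ++ s2 -> len (foldl (g x) (z x) s1) <= M x) ->
  polytime (fun x => foldl (g x) (z x) (s x)).
Proof.
move=> ptz pts ptg Mb lM.
(* The loop carries the parameter, the accumulator and the unread rest of the list. *)
pose body (y : X * (A * seq B)) : X * (A * seq B) :=
  (y.1, (g y.1 y.2.1 (head (@dflt B dB) y.2.2), behead y.2.2)).
have ptb : polytime body.
  have pt1 : polytime (fun y : X * (A * seq B) => y.1) by apply/polytime_fst/polytime_id.
  have pt2 : polytime (fun y : X * (A * seq B) => y.2) by apply/polytime_snd/polytime_id.
  have ptl : polytime (fun y : X * (A * seq B) => y.2.2) by apply/polytime_snd.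
  rewrite /body; apply: polytime_pair => //; apply: polytime_pair; last exact: polytime_behead.
  apply: (polytime_comp (f := fun y : X * (A * seq B) => (y.1, y.2.1, head dflt y.2.2)) _ ptg).
  apply: polytime_pair; last exact: polytime_head.
  by apply: polytime_pair => //; apply: polytime_fst.
pose c (y : X * (A * seq B)) := ~~ nilp y.2.2.
have ptc : polytime c.
  by rewrite /c; apply/polytime_negb/polytime_nilp/polytime_snd/polytime_snd/polytime_id.
pose init x := (x, (z x, s x)).
have pti : polytime init by rewrite /init; apply: polytime_pair; [exact: polytime_id|exact: polytime_pair].
have iterE x k : k <= size (s x) -> iter k body (init x) =
    (x, (foldl (g x) (z x) (take k (s x)), drop k (s x))).
  elim: k => [|k IH] kn; first by rewrite take0 drop0.
  rewrite iterS IH ?(ltnW kn) // /body /= -drop1 drop_drop add1n.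
  congr (_, (_, _)); rewrite (take_nth dflt) // foldl_rcons.
  by rewrite -nth0 nth_drop addn0.
have cE x k : k <= size (s x) -> c (iter k body (init x)) = (k < size (s x)).
  by move=> kn; rewrite /c iterE //= /nilp size_drop subn_eq0 ltnNge.
have lend x k : len (drop k (s x)) <= len (s x).
  elim: (s x) k => [|b t IH] [|k] //=; apply: leq_trans (IH k) _.
  by rewrite len_cons; lia.
case: ptc => p [T [[d Td] pT]]; case: ptb => q [U [[e Ue] qU]].
have sb := polyb_len pts.
case: (pti) => r [V [Vb rV]].
pose (Mx x := (len x + (M x + len (s x)).+1).+1).
pose L x := (Mx x).+1 ^ d + (Mx x).+1 ^ e.
have lenI x k : k <= size (s x) -> len (iter k body (init x)) <= Mx x.
  move=> kn; rewrite iterE // !len_pair.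
  have := lend x k; have := lM x (take k (s x)) (drop k (s x)).
  by rewrite cat_take_drop /Mx => /(_ erefl); lia.
have szs x : size (s x) <= len (s x).
  by elim: (s x) => [|b t IH] //; rewrite len_cons /=; lia.
have [pf [W [Wb pW]]] : polytime (fun y : X * (A * seq B) => y.2.1).
  by apply/polytime_fst/polytime_snd/polytime_id.
case: Wb => w Wb.
exists (PSeq r (PSeq (PWhile p q) pf)), (fun x => len x + V x +
  (Mx x + (len (s x)).+1 * (3 * L x) + (Mx x).+1 ^ w)); split.
  by rewrite /L /Mx; polyb.
move=> x; have [t1 e1 l1] := rV x.
have [|||t2 e2 l2] := @exec_while p q (fun k => enc (iter k body (init x)))
    (size (s x)) (L x).
- move=> k kn; have [u eu lu] := pT (iter k body (init x)).
  rewrite cE ?(ltnW kn) // kn in eu.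
  exists (VNum 1), u; split=> //.
  apply: leq_trans lu _; apply: leq_trans (Td _) _; apply: leq_trans (leq_addr _ _).
  by apply: leq_exp2; rewrite ltnS lenI // ltnW.
- have [u eu lu] := pT (iter (size (s x)) body (init x)).
  rewrite cE // ltnn in eu.
  exists u => //.
  apply: leq_trans lu _; apply: leq_trans (Td _) _; apply: leq_trans (leq_addr _ _).
  by apply: leq_exp2; rewrite ltnS lenI.
- move=> k kn; have [u eu lu] := qU (iter k body (init x)); exists u => //.
  apply: leq_trans lu _; apply: leq_trans (Ue _) _; apply: leq_trans (leq_addl _ _).
  by apply: leq_exp2; rewrite ltnS lenI // ltnW.
have [t3 e3 l3] := pW (iter (size (s x)) body (init x)).
rewrite {2}iterE //= take_size in e3.
eexists; first exact: exec_seq e1 (exec_seq e2 e3).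
have {}l3 : t3 <= (Mx x).+1 ^ w.
  by apply: leq_trans l3 _; apply: leq_trans (Wb _) _; apply: leq_exp2; rewrite ltnS lenI.
have {}l2 : t2 <= (len (s x)).+1 * (3 * L x).
  by apply: leq_trans l2 _; rewrite leq_mul2r ltnS szs orbT.
have li : value_len (enc (init x)) <= Mx x by apply: (lenI x 0).
exact: (leq_add (leq_add (leqnn _) l1) (leq_add (leq_add li l2) l3)).
Qed.

End Loops.

Lemma size_le_len {A} {dA : data A} (s : seq A) : size s <= len s.
Proof. by elim: s => [|b t IH] //; rewrite len_cons /=; lia. Qed.

Lemma all_len {A} {dA : data A} (s : seq A) : all (fun b => len b <= len s) s.
Proof.
elim: s => [|b t IH] //=; rewrite len_cons; apply/andP; split; first by lia.
by apply: sub_all IH => c /=; lia.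
Qed.

Lemma len_le_size {A} {dA : data A} (s : seq A) m :
  all (fun b => len b <= m) s -> len s <= (size s * m.+1).+1.
Proof.
by elim: s => [|b t IH] //= /andP[bm /IH]; rewrite len_cons /=; lia.
Qed.

Lemma len_cat {A} {dA : data A} (s t : seq A) : (len (s ++ t)).+1 = len s + len t.
Proof.
elim: s => [|b s IH] /=; first by rewrite /len /= add1n.
by rewrite !len_cons; lia.
Qed.

Lemma len_catrev {A} {dA : data A} (s t : seq A) :
  (len (catrev s t)).+1 = len s + len t.
Proof.
elim: s t => [|b s IH] t /=; first by rewrite /len /= add1n.
by rewrite IH !len_cons; lia.
Qed.

(** * Polynomial time of list operations *)

Section Lists.
Context {X A B : Type} {dX : data X} {dA : data A} {dB : data B}.
Implicit Types (s : X -> seq B) (F : X -> B -> A).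

Lemma elem_bound s F :
  polytime s -> polytime (fun y : X * B => F y.1 y.2) ->
  exists2 M, polyb len M & forall x, all (fun b => len (F x b) <= M x) (s x).
Proof.
move=> pts ptF; have sb := polyb_len pts; have [c Fc] := polyb_len ptF.
exists (fun x => ((len x + len (s x)).+1).+1 ^ c); first by polyb.
move=> x; apply: sub_all (all_len (s x)) => b /= bs.
apply: leq_trans (Fc (x, b)) _; apply: leq_exp2.
by rewrite len_pair; lia.
Qed.

Lemma polytime_rev s : polytime s -> polytime (fun x => rev (s x)).
Proof.
move=> pts.
apply: (polytime_ext (f := fun x => foldl (fun acc b => b :: acc) [::] (s x))).
  move=> x; rewrite -[RHS]cats0 -catrevE.
  by elim: (s x) [::] => //= b t IH u; rewrite IH.
apply: (polytime_foldl (g := fun _ acc b => b :: acc) (M := fun x => len (s x))) => //.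
- exact: polytime_const.
- apply: polytime_cons; first exact/polytime_snd/polytime_id.
  exact/polytime_snd/polytime_fst/polytime_id.
- exact: polyb_len.
move=> x s1 s2 ->.
have -> u : foldl (fun acc b => b :: acc) u s1 = catrev s1 u.
  by elim: s1 u => //= b t IH u; rewrite IH.
pose proof (len_catrev s1 [::]) as h1; pose proof (len_cat s1 s2) as h2; pose proof (len_gt0 s2) as h3.
have n1 : len (@nil B) = 1 by [].
lia.
Qed.

End Lists.

Section Lists2.
Context {X A B : Type} {dX : data X} {dA : data A} {dB : data B}.
Implicit Types (s t : X -> seq B) (F : X -> B -> A).

Lemma polytime_cat s t : polytime s -> polytime t -> polytime (fun x => s x ++ t x).
Proof.
move=> pts ptt.
have catE (u v : seq B) : foldl (fun acc b => b :: acc) u v = catrev v u.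
  by elim: v u => //= b v IH u; rewrite IH.
apply: (polytime_ext (f := fun x => foldl (fun acc b => b :: acc) (t x) (rev (s x)))).
  by move=> x; rewrite catE catrevE revK.
apply: (polytime_foldl (g := fun _ acc b => b :: acc)
          (M := fun x => len (rev (s x)) + len (t x))) => //.
- exact: polytime_rev.
- apply: polytime_cons; first exact/polytime_snd/polytime_id.
  exact/polytime_snd/polytime_fst/polytime_id.
- apply: polyb_add => //; last exact: polyb_len.
  exact/polyb_len/polytime_rev.
move=> x s1 s2 ->; rewrite catE; pose proof (len_catrev s1 (t x)) as h4.
pose proof (len_cat s1 s2) as h5; pose proof (len_gt0 s2) as h6; lia.
Qed.

Lemma polytime_sum s (P : X -> B -> bool) (F : X -> B -> nat) :
  polytime s -> polytime (fun y : X * B => P y.1 y.2) ->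
  polytime (fun y : X * B => F y.1 y.2) ->
  polytime (fun x => \sum_(b <- s x | P x b) F x b).
Proof.
move=> pts ptP ptF.
pose G x b := if P x b then F x b else 0.
have ptG : polytime (fun y : X * B => G y.1 y.2).
  by apply: polytime_if => //; apply: polytime_const.
have sumE x (u : seq B) v :
    foldl (fun acc b => acc + G x b) v u = v + \sum_(b <- u) G x b.
  elim: u v => [|b u IH] v; first by rewrite big_nil addn0.
  by rewrite /= IH big_cons addnA.
apply: (polytime_ext (f := fun x => foldl (fun acc b => acc + G x b) 0 (s x))).
  by move=> x; rewrite sumE add0n -big_mkcond.
have [M Mb Ms] := elem_bound pts ptG.
apply: (polytime_foldl (g := fun x acc b => acc + G x b)
          (M := fun x => 1 + len (s x) * M x)) => //.
- exact: polytime_const.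
- apply: polytime_add; first exact/polytime_snd/polytime_fst/polytime_id.
  apply: (polytime_comp (f := fun y : X * nat * B => (y.1.1, y.2)) _ ptG).
  apply: polytime_pair; last exact/polytime_snd/polytime_id.
  exact/polytime_fst/polytime_fst/polytime_id.
- by have sb := polyb_len pts; polyb.
move=> x s1 s2 sx; rewrite sumE add0n.
have : len (\sum_(b <- s1) G x b) <= 1 + size s1 * M x.
  move: (Ms x); rewrite sx all_cat => /andP[+ _].
  elim: s1 {sx} => [|b s1 IH] /=; first by rewrite big_nil.
  case/andP=> bM /IH h; rewrite big_cons; apply: leq_trans (len_add _ _) _.
  by rewrite mulSn; move: h bM; move: (_ * _) => w; lia.
move/leq_trans; apply; rewrite leq_add2l leq_mul2r.
apply/orP; right; apply: leq_trans (size_le_len _).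
by rewrite sx size_cat leq_addr.
Qed.

Lemma polytime_map s F :
  polytime s -> polytime (fun y : X * B => F y.1 y.2) ->
  polytime (fun x => [seq F x b | b <- s x]).
Proof.
move=> pts ptF.
have mapE x (u : seq B) v : foldl (fun acc b => F x b :: acc) v u = rev (map (F x) u) ++ v.
  by elim: u v => [|b u IH] v //=; rewrite IH rev_cons cat_rcons.
apply: (polytime_ext (f := fun x => rev (foldl (fun acc b => F x b :: acc) [::] (s x)))).
  by move=> x; rewrite mapE cats0 revK.
apply: polytime_rev; have [M Mb Ms] := elem_bound pts ptF.
apply: (polytime_foldl (g := fun x acc b => F x b :: acc)
          (M := fun x => (len (s x) * (M x).+1).+1)) => //.
- exact: polytime_const.
- apply: polytime_cons; last exact/polytime_snd/polytime_fst/polytime_id.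
  apply: (polytime_comp (f := fun y : X * seq A * B => (y.1.1, y.2)) _ ptF).
  apply: polytime_pair; last exact/polytime_snd/polytime_id.
  exact/polytime_fst/polytime_fst/polytime_id.
- by have sb := polyb_len pts; polyb.
move=> x s1 s2 sx; rewrite mapE cats0.
have /len_le_size : all (fun a => len a <= M x) (rev (map (F x) s1)).
  by move: (Ms x); rewrite all_rev all_map sx all_cat => /andP[+ _].
move/leq_trans; apply; rewrite ltnS leq_mul2r /=.
rewrite size_rev size_map; apply: leq_trans (size_le_len _).
by rewrite sx size_cat leq_addr.
Qed.

Lemma polytime_has s (P : X -> B -> bool) :
  polytime s -> polytime (fun y : X * B => P y.1 y.2) ->
  polytime (fun x => has (P x) (s x)).
Proof.
move=> pts ptP.
apply: (polytime_ext (f := fun x => ~~ (\sum_(b <- s x | P x b) 1 == 0))).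
  by move=> x; rewrite sum1_count has_count lt0n.
apply/polytime_negb/polytime_eq0/polytime_sum => //; exact: polytime_const.
Qed.

Lemma polytime_size s : polytime s -> polytime (fun x => size (s x)).
Proof.
move=> pts; apply: (polytime_ext (f := fun x => \sum_(b <- s x | true) 1)).
  by move=> x; rewrite sum1_size.
by apply: polytime_sum => //; apply: polytime_const.
Qed.

End Lists2.

Section Lists3.
Context {X A B : Type} {dX : data X} {dA : data A} {dB : data B}.

Lemma polytime_flatten (s : X -> seq (seq B)) :
  polytime s -> polytime (fun x => flatten (s x)).
Proof.
move=> pts.
have flatE (u : seq (seq B)) v : foldl cat v u = v ++ flatten u.
  by elim: u v => [|b u IH] v /=; rewrite ?cats0 // IH catA.
apply: (polytime_ext (f := fun x => foldl cat [::] (s x))); first by move=> x; rewrite flatE.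
apply: (polytime_foldl (g := fun _ => cat) (M := fun x => len (s x))) => //.
- exact: polytime_const.
- apply: polytime_cat; last exact/polytime_snd/polytime_id.
  exact/polytime_snd/polytime_fst/polytime_id.
- exact: polyb_len.
move=> x s1 s2 ->; rewrite flatE /=.
elim: s1 => [|b s1 IH] /=; first exact: len_gt0.
by pose proof (len_cat b (flatten s1)) as h8; rewrite len_cons; lia.
Qed.

Lemma len_foldl_select (P : A -> B -> bool) (h : B -> A) (z : A) (s : seq B) m :
  len z <= m -> all (fun b => len (h b) <= m) s ->
  len (foldl (fun acc b => if P acc b then h b else acc) z s) <= m.
Proof.
elim: s z => [|b s IH] z //= zm /andP[bm sm]; apply: IH => //.
by case: ifP.
Qed.

Lemma polytime_nth (s : X -> seq B) (i : X -> nat) :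
  polytime s -> polytime i -> polytime (fun x => nth dflt (s x) (i x)).
Proof.
move=> pts pti.
(* The accumulator counts the elements read and holds the wanted one once it has passed. *)
pose g (n : nat) (acc : nat * B) (b : B) :=
  (acc.1.+1, if acc.1 == n then b else acc.2).
have gE n k (c : B) u : foldl (g n) (k, c) u =
    (k + size u, if n < k then c else nth c u (n - k)).
  elim: u k c => [|b u IH] k c /=; first by rewrite addn0 nth_nil if_same.
  rewrite IH addSnnS; congr pair; case: (ltngtP n k) => nk.
  - by rewrite ltnS ltnW.
  - rewrite ltnS leqNgt nk /=.
    by have -> : n - k = (n - k.+1).+1 by lia.
  - by rewrite nk leqnn subnn.
apply: (polytime_ext (f := fun x => (foldl (g (i x)) (0, dflt) (s x)).2)).
  by move=> x; rewrite gE /= subn0.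
apply/polytime_snd.
apply: (polytime_foldl (g := fun x => g (i x))
  (M := fun x => ((len (s x)).+1 + (len (s x) + len (@dflt B dB))).+1)) => //.
- exact: polytime_const.
- have p1 : polytime (fun y : X * (nat * B) * B => y.1.2.1).
    exact/polytime_fst/polytime_snd/polytime_fst/polytime_id.
  apply: polytime_pair.
    apply: (polytime_ext (f := fun y : X * (nat * B) * B => y.1.2.1 + 1)).
      by move=> y; rewrite addn1.
    by apply: polytime_add => //; apply: polytime_const.
  apply: polytime_if; last exact/polytime_snd/polytime_snd/polytime_fst/polytime_id.
    apply: polytime_eqn => //; apply: (polytime_comp _ pti).
    exact/polytime_fst/polytime_fst/polytime_id.
  exact/polytime_snd/polytime_id.
- by have sb := polyb_len pts; polyb.
move=> x s1 s2 sx; rewrite gE len_pair ltnS leq_add //.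
  apply: leq_trans (len_nat_le _) _; rewrite ltnS; apply: leq_trans (size_le_len _).
  by rewrite sx size_cat leq_addr.
rewrite subn0; pose proof (all_len (s x)) as h; move: h; rewrite {2}sx all_cat => /andP[+ _].
move: (len (s x)) => m; elim: s1 (i x) {sx} => [|b s1 IH] [|k] /=; try lia.
by case/andP=> _; apply: IH.
Qed.

Lemma polytime_index (s : X -> seq nat) (i : X -> nat) :
  polytime s -> polytime i -> polytime (fun x => index (i x) (s x)).
Proof.
move=> pts pti.
pose g (n : nat) (acc : nat * bool) (b : nat) :=
  if acc.2 || (b == n) then (acc.1, true) else (acc.1.+1, false).
have gT n k u : foldl (g n) (k, true) u = (k, true) by elim: u.
have gE n k u : (foldl (g n) (k, false) u).1 = k + index n u.
  elim: u k => [|b u IH] k /=; first by rewrite addn0.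
  rewrite {2}/g /=; case: eqP => _; first by rewrite gT addn0.
  by rewrite IH addSnnS.
apply: (polytime_ext (f := fun x => (foldl (g (i x)) (0, false) (s x)).1)).
  by move=> x; rewrite gE.
apply/polytime_fst.
apply: (polytime_foldl (g := fun x => g (i x))
  (M := fun x => ((len (s x)).+1 + 1).+1)) => //.
- exact: polytime_const.
- have p1 : polytime (fun y : X * (nat * bool) * nat => y.1.2.1).
    exact/polytime_fst/polytime_snd/polytime_fst/polytime_id.
  apply: polytime_if.
  + apply: polytime_orb; first exact/polytime_snd/polytime_snd/polytime_fst/polytime_id.
    apply: polytime_eqn; first exact/polytime_snd/polytime_id.
    apply: (polytime_comp _ pti); exact/polytime_fst/polytime_fst/polytime_id.
  + by apply: polytime_pair => //; apply: polytime_const.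
  + apply: polytime_pair; last exact: polytime_const.
    apply: (polytime_ext (f := fun y : X * (nat * bool) * nat => y.1.2.1 + 1)).
      by move=> y; rewrite addn1.
    by apply: polytime_add => //; apply: polytime_const.
- by have sb := polyb_len pts; polyb.
move=> x s1 s2 sx; rewrite [foldl _ _ _]surjective_pairing len_pair gE ltnS leq_add //.
  apply: leq_trans (len_nat_le _) _; rewrite ltnS; apply: leq_trans (size_le_len _).
  by rewrite sx size_cat; apply: leq_trans (index_size _ _) (leq_addr _ _).
rewrite /len /=; case: (_.2) => //.
Qed.

End Lists3.

Lemma polytime_S {X} {dX : data X} (f : X -> nat) :
  polytime f -> polytime (fun x => (f x).+1).
Proof.
move=> ptf; apply: (polytime_ext (f := fun x => f x + 1)); first by move=> x; rewrite addn1.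
by apply: polytime_add => //; apply: polytime_const.
Qed.

(** The bound is the size of a list: for a number given in binary the output could be exponentially
    long. *)
Lemma polytime_iota {X B} {dX : data X} {dB : data B} (s : X -> seq B) :
  polytime s -> polytime (fun x => iota 0 (size (s x))).
Proof.
move=> pts.
have E (u : seq B) v : foldl (fun acc _ => size acc :: acc) v u =
    rev (iota (size v) (size u)) ++ v.
  by elim: u v => [|b u IH] v //=; rewrite IH /= rev_cons cat_rcons.
apply: (polytime_ext (f := fun x => rev (foldl (fun acc _ => size acc :: acc) [::] (s x)))).
  by move=> x; rewrite E cats0 revK.
apply: polytime_rev.
apply: (polytime_foldl (g := fun _ acc _ => size acc :: acc)
  (M := fun x => (len (s x) * (len (s x)).+2).+1)) => //.
- exact: polytime_const.
- apply: polytime_cons; first apply: polytime_size.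
    exact/polytime_snd/polytime_fst/polytime_id.
  exact/polytime_snd/polytime_fst/polytime_id.
- by have sb := polyb_len pts; polyb.
move=> x s1 s2 sx; rewrite E cats0.
have s1x : size s1 <= len (s x).
  by apply: leq_trans (size_le_len _); rewrite sx size_cat leq_addr.
apply: leq_trans (@len_le_size _ _ _ (len (s x)).+1 _) _.
  rewrite all_rev; apply/allP => k; rewrite mem_iota add0n /= => ks.
  by apply: leq_trans (len_nat_le _) _; rewrite ltnS; lia.
by rewrite size_rev size_iota ltnS leq_mul2r s1x orbT.
Qed.

(** * The algorithm *)

(* Job number, processing time, the two weights, and the positions of the job
   in the two orders; the second position is counted from 1, as in pi. *)
Notation item := (nat * nat * nat * nat * nat * nat)%type.
Definition it_id (a : item) := a.1.1.1.1.1.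
Definition it_p (a : item) := a.1.1.1.1.2.
Definition it_wE (a : item) := a.1.1.1.2.
Definition it_wL (a : item) := a.1.1.2.
Definition it_posE (a : item) := a.1.2.
Definition it_posL (a : item) := a.2.

(* A partial solution: each job of a block is marked early ([true]) or tardy. *)
Notation state := (seq (item * bool)).

Definition sumE (h : item -> nat) (s : state) := \sum_(a <- s | a.2) h a.1.
Definition sumL (h : item -> nat) (s : state) := \sum_(a <- s | ~~ a.2) h a.1.

(** A smaller position lies farther from the due date. The tardy comparison is not strict because
    the lateness of a job includes its own processing time, whereas its earliness does not. *)
Definition pair_cost (a b : item * bool) :=
  (if [&& a.2, b.2 & it_posE a.1 < it_posE b.1] then it_wE a.1 * it_p b.1 else 0) +
  (if [&& ~~ a.2, ~~ b.2 & it_posL a.1 <= it_posL b.1] then it_wL a.1 * it_p b.1 else 0).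

Definition st_cost (s : state) := \sum_(a <- s) \sum_(b <- s) pair_cost a b.

(** The ratio 1 + 1/K is cleared of its denominator, so that the program can test it on naturals. *)
Definition approx_le K (m n : nat) := K * m <= K.+1 * n.

Definition dominates K (s t : state) :=
  [&& approx_le K (sumE it_p s) (sumE it_p t),
      approx_le K (sumL it_p s) (sumL it_p t),
      approx_le K (sumE it_wE s) (sumE it_wE t),
      approx_le K (sumL it_wL s) (sumL it_wL t)
    & approx_le K (st_cost s) (st_cost t)].

Definition trim K (S : seq state) :=
  foldl (fun acc s => if has (fun t => dominates K t s) acc then acc else s :: acc) [::] S.

Notation block := (seq item * seq state)%type.

Definition merge_blocks K (b1 b2 : block) : block :=
  (b1.1 ++ b2.1, trim K (flatten [seq [seq s ++ t | t <- b2.2] | s <- b1.2])).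

(** Two disjoint intervals have an interval as union exactly when they contain a pair of consecutive
    numbers. *)
Definition adjacent (u v : seq nat) :=
  has (fun x : nat => has (fun y : nat => (x.+1 == y) || (y.+1 == x)) v) u.

Definition leaf_block (a : item) : block := ([:: a], [:: [:: (a, true)]; [:: (a, false)]]).

Definition config := (seq block * seq item)%type.

(* Shift-reduce parsing of the ratio permutation: the two topmost blocks are
   merged whenever their labels form an interval. *)
Definition step K (y : config) : config :=
  let b2 := head dflt y.1 in
  let b1 := head dflt (behead y.1) in
  if ~~ nilp (behead y.1) && adjacent (map it_posL b1.1) (map it_posL b2.1) then
    (merge_blocks K b1 b2 :: behead (behead y.1), y.2)
  else if nilp y.2 then y
  else (leaf_block (head dflt y.2) :: y.1, behead y.2).

(** The precision arrives as the length of the list [m], that is, in unary. The factor 4 makes the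
    total loss at most 1 + 1/m, see [growth_le]. *)
Definition scale (m : seq nat) (W : seq item) := 4 * size W * size m.

(** The list [W ++ W] is only a clock: each job is shifted once, there are fewer merges than jobs,
    and afterwards [step] changes nothing. *)
Definition run (m : seq nat) (W : seq item) : config :=
  foldl (fun y _ => step (scale m W) y) ([::], W) (W ++ W).

Definition best (S : seq state) : state :=
  foldl (fun acc s => if st_cost s < st_cost acc then s else acc) (head dflt S) S.

(** The outer sum looks up job [j] and has one term when the identifiers are distinct; the sums over
    all of [s] stand for the due date. *)
Definition start (s : state) (j : nat) :=
  \sum_(a <- s | it_id a.1 == j)
    (if a.2
     then \sum_(b <- s) it_p b.1 - \sum_(b <- s | b.2 && (it_posE a.1 <= it_posE b.1)) it_p b.1
     else \sum_(b <- s) it_p b.1 + \sum_(b <- s | ~~ b.2 && (it_posL a.1 < it_posL b.1)) it_p b.1).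

(** The nesting is chosen so that [enc] produces the prescribed input encoding. *)
Notation raw_jobs := (seq (nat * (nat * nat))).
Notation raw_input := ((nat * nat) * (raw_jobs * (seq nat * seq nat)))%type.

Definition mk_item (jobs : raw_jobs) (oE oL : seq nat) (j : nat) : item :=
  (j, (nth dflt jobs j).1, (nth dflt jobs j).2.1, (nth dflt jobs j).2.2,
   index j oE, (index j oL).+1).

Definition mk_items (x : raw_input) : seq item :=
  [seq mk_item x.2.1 x.2.2.1 x.2.2.2 j | j <- x.2.2.1].

Definition solution (m : seq nat) (x : raw_input) : state :=
  best (head dflt (run m (mk_items x)).1).2.

(** All start times are integers; the 1 is the denominator of the reduced fraction. *)
Definition solve (y : seq nat * raw_input) : seq (nat * nat) :=
  [seq (start (solution y.1 y.2) j, 1) | j <- iota 0 (size y.2.2.1)].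

(** * Polynomial time of the single steps of the algorithm *)

Ltac pt_step := lazymatch goal with
  | H : polytime_wrt len ?f |- polytime_wrt len ?f => exact: H
  | |- polytime_wrt _ (@fst _ _) => exact: (polytime_fst polytime_id)
  | |- polytime_wrt _ (@snd _ _) => exact: (polytime_snd polytime_id)
  | |- polytime_wrt _ (fun x => x) => exact: polytime_id
  | |- polytime_wrt _ (fun _ => ?c) => exact: polytime_const
  | |- polytime_wrt _ (fun x => (_, _)) => apply: polytime_pair
  | |- polytime_wrt _ (fun x => fst _) => apply: polytime_fst
  | |- polytime_wrt _ (fun x => snd _) => apply: polytime_snd
  | |- polytime_wrt _ (fun x => _ < _) => apply: polytime_ltn
  | |- polytime_wrt _ (fun x => _ <= _) => apply: polytime_leq
  | |- polytime_wrt _ (fun x => _ == _) => apply: polytime_eqn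
  | |- polytime_wrt _ (fun x => _ && _) => apply: polytime_andb
  | |- polytime_wrt _ (fun x => _ || _) => apply: polytime_orb
  | |- polytime_wrt _ (fun x => ~~ _) => apply: polytime_negb
  | |- polytime_wrt _ (fun x => _.+1) => apply: polytime_S
  | |- polytime_wrt _ (fun x => _ + _) => apply: polytime_add
  | |- polytime_wrt _ (fun x => _ * _) => apply: polytime_mul
  | |- polytime_wrt _ (fun x => _ - _) => apply: polytime_sub
  | |- polytime_wrt _ (fun x => _ %/ _) => apply: polytime_div
  | |- polytime_wrt _ (fun x => if _ then _ else _) => apply: polytime_if
  | |- polytime_wrt _ (fun x => _ :: _) => apply: polytime_cons
  | |- polytime_wrt _ (fun x => _ ++ _) => apply: polytime_cat
  | |- polytime_wrt _ (fun x => nilp _) => apply: polytime_nilp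
  | |- polytime_wrt _ (fun x => behead _) => apply: polytime_behead
  | |- polytime_wrt _ (fun x => head _ _) => apply: polytime_head
  | |- polytime_wrt _ (fun x => nth _ _ _) => apply: polytime_nth
  | |- polytime_wrt _ (fun x => index _ _) => apply: polytime_index
  | |- polytime_wrt _ (fun x => size _) => apply: polytime_size
  | |- polytime_wrt _ (fun x => flatten _) => apply: polytime_flatten
  | |- polytime_wrt _ (fun x => iota 0 (size _)) => apply: polytime_iota
  | |- polytime_wrt _ (fun x => map _ _) => apply: polytime_map
  | |- polytime_wrt _ (fun x => has _ _) => apply: polytime_has
  | |- polytime_wrt _ (fun x => \sum_(_ <- _ | _) _) => apply: polytime_sum
  end.
Ltac pt := repeat pt_step.

Section PolytimeState.
Context {X : Type} {dX : data X}.

Lemma polytime_sumE (h : item -> nat) (s : X -> state) :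
  polytime h -> polytime s -> polytime (fun x => sumE h (s x)).
Proof.
move=> pth pts; rewrite /sumE; pt.
by apply: (polytime_comp _ pth); pt.
Qed.

Lemma polytime_sumL (h : item -> nat) (s : X -> state) :
  polytime h -> polytime s -> polytime (fun x => sumL h (s x)).
Proof.
move=> pth pts; rewrite /sumL; pt.
by apply: (polytime_comp _ pth); pt.
Qed.

Lemma polytime_st_cost (s : X -> state) : polytime s -> polytime (fun x => st_cost (s x)).
Proof.
move=> pts; rewrite /st_cost; pt.
  by apply: (polytime_comp _ pts); pt.
by rewrite /pair_cost /it_posE /it_posL /it_wE /it_p /it_wL; pt.
Qed.

Lemma polytime_approx_le (K m n : X -> nat) : polytime K -> polytime m -> polytime n ->
  polytime (fun x => approx_le (K x) (m x) (n x)).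
Proof.
move=> ptK ptm ptn; by rewrite /approx_le; pt.
Qed.

Lemma polytime_dominates (K : X -> nat) (s t : X -> state) :
  polytime K -> polytime s -> polytime t -> polytime (fun x => dominates (K x) (s x) (t x)).
Proof.
move=> ptK pts ptt; rewrite /dominates /it_p /it_wE /it_wL.
by do !apply: polytime_andb; apply: polytime_approx_le => //;
  (apply: polytime_sumE || apply: polytime_sumL || apply: polytime_st_cost) => //; pt.
Qed.

End PolytimeState.

Section PolytimeRun.
Context {X : Type} {dX : data X}.

Lemma len_trim_aux (P : seq state -> state -> bool) (acc S : seq state) :
  len (foldl (fun acc s => if P acc s then acc else s :: acc) acc S) <= len acc + len S.
Proof.
elim: S acc => [|s S IH] acc /=; first exact: leq_addr.
by apply: leq_trans (IH _) _; rewrite len_cons; case: ifP => _; rewrite ?len_cons; lia.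
Qed.

Lemma polytime_trim (K : X -> nat) (S : X -> seq state) :
  polytime K -> polytime S -> polytime (fun x => trim (K x) (S x)).
Proof.
move=> ptK ptS; rewrite /trim.
apply: (polytime_foldl
  (g := fun x acc s => if has (fun t => dominates (K x) t s) acc then acc else s :: acc)
  (M := fun x => 1 + len (S x))) => //.
- exact: polytime_const.
- pt; apply: polytime_dominates; pt.
  by apply: (polytime_comp _ ptK); pt.
- by have sb := polyb_len ptS; polyb.
move=> x s1 s2 ->; apply: leq_trans (len_trim_aux _ _ _) _.
by rewrite leq_add2l; pose proof (len_cat s1 s2) as h1; pose proof (len_gt0 s2) as h2; lia.
Qed.

Lemma polytime_merge (K : X -> nat) (b1 b2 : X -> block) :
  polytime K -> polytime b1 -> polytime b2 -> polytime (fun x => merge_blocks (K x) (b1 x) (b2 x)).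
Proof.
move=> ptK pt1 pt2; rewrite /merge_blocks; pt.
apply: polytime_trim => //; pt.
by apply: (polytime_comp _ pt2); pt.
Qed.

Lemma polytime_step (K : X -> nat) (y : X -> config) :
  polytime K -> polytime y -> polytime (fun x => step (K x) (y x)).
Proof.
move=> ptK pty; rewrite /step /adjacent /leaf_block; pt.
  by apply: (polytime_comp _ pty); pt.
by apply: polytime_merge; pt.
Qed.

End PolytimeRun.

(** * Geometric boxes and the number of retained states *)

(** Each octave from 2^t to 2^(t+1) is cut into K parts of equal width. The quotient is below 2K, so
    it and t are recovered from the box number by division by 2K. *)
Definition box K v := trunc_log 2 v * (2 * K) + (v * K) %/ 2 ^ trunc_log 2 v.

Lemma box_quotient_lt K v : 0 < K -> (v * K) %/ 2 ^ trunc_log 2 v < 2 * K.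
Proof.
move=> K0; rewrite ltn_divLR ?expn_gt0 //.
have := trunc_log_ltn v (isT : 1 < 2); rewrite expnS.
by move: (2 ^ _) => w; nia.
Qed.

Lemma box_lt K v T : trunc_log 2 v <= T -> box K v < (T.+1 * (2 * K)).+1.
Proof.
move=> vT; rewrite ltnS /box; case: (posnP K) => [->|K0].
  by rewrite !muln0 div0n.
by have := box_quotient_lt v K0; nia.
Qed.

(* With t = trunc_log 2 v, equal boxes determine t and the integer part q >= K
   of v K / 2^t, so the ratio of two members is at most (q + 1) / q. *)
Lemma box_approx_le K u v : box K u = box K v -> approx_le K u v.
Proof.
rewrite /approx_le; have [->|K0] := posnP K; first by rewrite mul0n.
have [->|u0] := posnP u; first by rewrite muln0.
have qge w : 0 < w -> K <= (w * K) %/ 2 ^ trunc_log 2 w.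
  move=> w0; rewrite leq_divRL ?expn_gt0 // mulnC leq_mul2r.
  by have /andP[-> _] := trunc_log_bounds (isT : 1 < 2) w0; rewrite orbT.
(* Zero has box 0, while a positive number has quotient at least K, so the two never share a box. *)
have [->|v0] := posnP v.
  rewrite /box trunc_log0 mul0n mul0n div0n addn0 => /eqP.
  by rewrite addn_eq0 => /andP[_ /eqP q0]; have := qge u u0; lia.
rewrite /box => E.
have K2 : 0 < 2 * K by lia.
have Et : trunc_log 2 u = trunc_log 2 v.
  have := congr1 (divn^~ (2 * K)) E.
  by rewrite !divnMDl // !(divn_small (box_quotient_lt _ K0)) !addn0.
have Eq : (u * K) %/ 2 ^ trunc_log 2 v = (v * K) %/ 2 ^ trunc_log 2 v.
  by move: E; rewrite Et => /addnI.
have /andP[tv _] := trunc_log_bounds (isT : 1 < 2) v0.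
have w0 : 0 < 2 ^ trunc_log 2 v by rewrite expn_gt0.
have := ltn_ceil (u * K) w0; rewrite Eq.
have := leq_trunc_div (v * K) (2 ^ trunc_log 2 v).
by move: tv; move: (_ %/ _) => q; move: (2 ^ _) => w; nia.
Qed.

Definition coords (s : state) : seq nat :=
  [:: sumE it_p s; sumL it_p s; sumE it_wE s; sumL it_wL s; st_cost s].

(** Pigeonhole: if two retained states had the same five boxes, the earlier one would dominate the
    later, which would have been discarded. *)
Lemma size_trim K T S :
  (forall s, s \in S -> all (fun v => trunc_log 2 v <= T) (coords s)) ->
  size (trim K S) <= ((T.+1 * (2 * K)).+1) ^ 5.
Proof.
set N := T.+1 * (2 * K) => ST.
pose code (s : state) : 5.-tuple 'I_N.+1 := [tuple of map (fun v => inord (box K v)) (coords s)].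
have codeP s t : s \in S -> t \in S -> code s = code t -> dominates K s t.
  move=> sS tS /(congr1 val) /= [e1 e2 e3 e4 e5].
  move: (ST s sS) (ST t tS) => /and5P[a1 a2 a3 a4 /andP[a5 _]] /and5P[b1 b2 b3 b4 /andP[b5 _]].
  have I u v : trunc_log 2 u <= T -> trunc_log 2 v <= T ->
      inord (box K u) = inord (box K v) :> 'I_N.+1 -> approx_le K u v.
    move=> uT vT /(congr1 (@nat_of_ord _)); rewrite !inordK; [|exact: box_lt..].
    exact: box_approx_le.
  by apply/and5P; split; apply: I.
suff [uS _] : uniq (map code (trim K S)) /\ {subset trim K S <= S}.
  by move/card_uniqP: uS (max_card (mem (map code (trim K S)))) => ->; rewrite size_map card_tuple card_ord.
rewrite /trim; elim/last_ind: S {ST} codeP => [|S s IH] // codeP.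
rewrite foldl_rcons.
have {}[|u sub] := IH.
  by move=> x y xS yS; apply: codeP; rewrite mem_rcons inE ?xS ?yS orbT.
have sub' : {subset trim K S <= rcons S s}.
  by move=> x /sub xS; rewrite mem_rcons inE xS orbT.
case: ifPn => // /hasPn nd; split; last first.
  move=> x; rewrite inE => /predU1P[->|/sub']; first by rewrite mem_rcons mem_head.
  by [].
rewrite /= u andbT; apply/mapP => -[t tS /esym e].
have := nd t tS; rewrite codeP //; first exact: sub'.
by rewrite mem_rcons mem_head.
Qed.

Lemma trim_subset K S : {subset trim K S <= S}.
Proof.
rewrite /trim; elim/last_ind: S => [|S s IH] // x.
rewrite foldl_rcons mem_rcons inE; case: ifP => _.
  by move/IH => ->; rewrite orbT.
by rewrite inE => /predU1P[->|/IH ->]; rewrite ?eqxx ?orbT.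
Qed.

Lemma approx_le_refl K : reflexive (approx_le K).
Proof. by move=> n; rewrite /approx_le leq_mul2r leqnSn orbT. Qed.

(** A retained state is never removed later, so no chain of dominations arises and one trimming
    costs a single factor. *)
Lemma trim_dominates K S s : s \in S -> exists2 t, t \in trim K S & dominates K t s.
Proof.
rewrite /trim; elim/last_ind: S => [|S u IH] //.
rewrite mem_rcons inE foldl_rcons => /predU1P[->|/IH[t tS ts]]; last first.
  by exists t => //; case: ifP => _ //; rewrite inE tS orbT.
case: ifPn => [/hasP[t tS tu]|_]; first by exists t.
exists u; first exact: mem_head.
by rewrite /dominates !approx_le_refl.
Qed.

(** * Invariants of the parser and size of its data *)

Definition block_wf (b : block) := all (fun s => unzip1 s == b.1) b.2.

(** The top of the stack is the head of the list, hence the reversal. This word stays equal to the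
    input, so every block is an infix of it. *)
Definition config_word (y : config) := flatten (rev (map fst y.1)) ++ y.2.

Lemma merge_mem K b1 b2 t : t \in (merge_blocks K b1 b2).2 ->
  exists s1 s2, [/\ s1 \in b1.2, s2 \in b2.2 & t = s1 ++ s2].
Proof.
move/trim_subset/flattenP => [l /mapP[s1 s1b ->] /mapP[s2 s2b ->]].
by exists s1, s2.
Qed.

Lemma merge_wf K b1 b2 : block_wf b1 -> block_wf b2 -> block_wf (merge_blocks K b1 b2).
Proof.
move=> /allP w1 /allP w2; apply/allP => t /merge_mem[s1 [s2 [m1 m2 ->]]].
by move: (w1 _ m1) (w2 _ m2); rewrite /unzip1 map_cat => /eqP -> /eqP ->.
Qed.

Variant step_spec K (st : seq block) (r : seq item) : config -> Prop :=
| StepMerge b1 b2 st' of st = b2 :: b1 :: st' &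
    adjacent (map it_posL b1.1) (map it_posL b2.1) :
    step_spec K st r (merge_blocks K b1 b2 :: st', r)
| StepShift a r' of r = a :: r' &
    (forall b1 b2 st', st = b2 :: b1 :: st' ->
       ~~ adjacent (map it_posL b1.1) (map it_posL b2.1)) :
    step_spec K st r (leaf_block a :: st, r')
| StepStop of r = [::] &
    (forall b1 b2 st', st = b2 :: b1 :: st' ->
       ~~ adjacent (map it_posL b1.1) (map it_posL b2.1)) :
    step_spec K st r (st, r).

Lemma stepP K st r : step_spec K st r (step K (st, r)).
Proof.
rewrite /step /=; case: ifPn => [|nadj].
  by case: st => [|b2 [|b1 st']] //= adj; apply: StepMerge.
have nadj' : forall b1 b2 st', st = b2 :: b1 :: st' ->
    ~~ adjacent (map it_posL b1.1) (map it_posL b2.1).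
  by move=> b1 b2 st' e; move: nadj; rewrite e.
by case: r => [|a r'] /=; [apply: StepStop|apply: StepShift].
Qed.

Lemma step_word K y : config_word (step K y) = config_word y.
Proof.
case: y => st r; case: stepP => [b1 b2 st' -> _|a r' -> _|_ _] //.
  by rewrite /config_word /= !rev_cons -!cats1 !flatten_cat /= !cats0 -!catA.
by rewrite /config_word /= rev_cons -cats1 flatten_cat /= -!catA.
Qed.

Lemma step_wf K y : all block_wf y.1 -> all block_wf (step K y).1.
Proof.
case: y => st r; case: stepP => [b1 b2 st' -> _|a r' -> _|_ _] //=.
  by case/and3P=> w2 w1 ->; rewrite merge_wf.
by move=> ->; rewrite /block_wf /= eqxx.
Qed.

Lemma len_infix {A} {dA : data A} (u v w : seq A) : len v <= len (u ++ v ++ w).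
Proof.
pose proof (len_cat u (v ++ w)) as h1; pose proof (len_cat v w) as h2.
by pose proof (len_gt0 u); pose proof (len_gt0 w); lia.
Qed.

Lemma sub_config_len y b : b \in y.1 -> len b.1 <= len (config_word y).
Proof.
case: y => st r /= bst.
have : map fst st = take (index b st) (map fst st) ++ b.1 :: drop (index b st).+1 (map fst st).
  by rewrite -{1}(cat_take_drop (index b st) (map fst st)) (drop_nth [::]) ?size_map ?index_mem //
     (nth_map b) ?index_mem // nth_index.
rewrite /config_word => ->; rewrite rev_cat rev_cons flatten_cat flatten_rcons -!catA.
exact: len_infix.
Qed.

Lemma len_unzip1 (s : state) : len s <= 3 * len (unzip1 s).
Proof.
elim: s => [|[a c] s IH] //=.
have h : len c = 1 by case: c.
rewrite !len_cons len_pair h; move: IH.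
by move: (len s) (len (unzip1 s)) (len a); lia.
Qed.

(** The total of the five sums is computable in polynomial time, so its number of digits is bounded
    by [polyb_len], which replaces explicit estimates. *)
Lemma coords_bound : exists e, forall s : state,
  all (fun v => trunc_log 2 v <= (len s).+1 ^ e) (coords s).
Proof.
have : polytime (fun s : state => sumE it_p s + (sumL it_p s + (sumE it_wE s + (sumL it_wL s + st_cost s)))).
  rewrite /it_p /it_wE /it_wL; pt; (apply: polytime_sumE || apply: polytime_sumL ||
    apply: polytime_st_cost); by pt.
move=> /polyb_len[e eb]; exists e => s; have := eb s.
rewrite {1}/len /= => h.
have {}h v : v <= sumE it_p s + (sumL it_p s + (sumE it_wE s + (sumL it_wL s + st_cost s))) ->
    trunc_log 2 v <= (len s).+1 ^ e.
  by move=> hv; apply: leq_trans (ltnW h); apply: leq_trunc_log.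
by rewrite /coords /= !h //; lia.
Qed.

Lemma config_bound K B y :
  (forall s : state, len (unzip1 s) <= len (config_word y) ->
     all (fun v => trunc_log 2 v <= B) (coords s)) ->
  all block_wf y.1 -> all (fun b => size b.2 <= (B.+1 * (2 * K)).+1 ^ 5 + 1) y.1 ->
  all (fun b => size b.2 <= (B.+1 * (2 * K)).+1 ^ 5 + 1) (step K y).1 /\
  size (step K y).1 <= (size y.1).+1.
Proof.
set N := _ ^ 5 => hB wf hN.
have wf' := step_wf K wf; have wd := step_word K y; rewrite -wd in hB.
have sub b := @sub_config_len (step K y) b.
case: y {wd} wf hN hB wf' sub => st r /=.
case: stepP => [b1 b2 st' -> adj|a r' _ _|_ _] /= wf hN hB wf' sub; last by split.
  case/and3P: hN => _ _ ->; split; last lia.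
  rewrite andbT; apply: leq_trans (leq_addr _ _); apply: size_trim => s sS; apply: hB.
  case/andP: wf' => _ _.
  have -> : unzip1 s = (merge_blocks K b1 b2).1.
    case/and3P: wf => /allP w2 /allP w1 _.
    move/flattenP: sS => [l /mapP[s1 m1 ->] /mapP[s2 m2 ->]].
    by move: (w1 _ m1) (w2 _ m2); rewrite /unzip1 map_cat => /eqP -> /eqP ->.
  by apply: sub; apply: mem_head.
rewrite hN andbT; split=> //.
(* A leaf block has two states, whence the summand 1 in the bound. *)
by rewrite addn1 ltnS expn_gt0.
Qed.

Lemma polytime_run {X} {dX : data X} (m : X -> seq nat) (W : X -> seq item) :
  polytime m -> polytime W -> polytime (fun x => run (m x) (W x)).
Proof.
move=> ptm ptW; rewrite /run.
have [e he] := coords_bound.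
pose (T x := (3 * len (W x)).+1 ^ e).
pose (N x := ((T x).+1 * (2 * scale (m x) (W x))).+1 ^ 5 + 1).
(* This is [N] with sizes replaced by lengths, hence visibly polynomial. It is here that the unary
   form of the precision matters, [size (m x)] being a factor of the scale. *)
pose (N' x := ((T x).+1 * (2 * (4 * len (W x) * len (m x)))).+1 ^ 5 + 1).
pose (Lb x := (len (W x) + (N' x * (3 * len (W x)).+1).+1).+1).
have bW := polyb_len ptW; have bm := polyb_len ptm.
apply: (polytime_foldl (g := fun x y _ => step (scale (m x) (W x)) y)
  (M := fun x => ((2 * len (W x) * (Lb x).+1).+1 + len (W x)).+1)).
- by pt.
- by pt.
- apply: polytime_step; last by pt.
  by rewrite /scale; pt; [apply: (polytime_comp _ ptW)|apply: (polytime_comp _ ptm)]; pt.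
- by rewrite /Lb /N' /T; polyb.
move=> x s1 s2 sx.
set y := foldl _ _ _.
have [wd [wf [hN hs]]] : config_word y = W x /\ all block_wf y.1 /\
    all (fun b => size b.2 <= N x) y.1 /\ size y.1 <= size s1.
  rewrite /y; elim/last_ind: s1 {sx y} => [|s1 a IH] //.
  rewrite foldl_rcons size_rcons; move: IH; set y := foldl _ _ _ => -[wd [wf [hN hs]]].
  rewrite step_word step_wf //; split=> //; split=> //.
  have [] := @config_bound (scale (m x) (W x)) (T x) y _ wf hN.
    move=> s sw; apply: sub_all (he s) => v /leq_trans; apply; rewrite /T.
    apply: leq_exp2; rewrite ltnS; apply: leq_trans (len_unzip1 s) _.
    by rewrite leq_mul2l /=; rewrite wd in sw.
  by move=> hN' hs'; split=> //; apply: leq_trans hs' _.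
have hNN : N x <= N' x.
  rewrite leq_add2r; apply: leq_exp2; rewrite ltnS leq_mul2l leq_mul2l /scale /=.
  by apply: leq_mul; rewrite ?leq_mul2l size_le_len // orbT.
have lb b : b \in y.1 -> len b <= Lb x.
  move=> by1; have lb1 : len b.1 <= len (W x) by rewrite -wd; apply: sub_config_len.
  have /allP wb : block_wf b by apply: (allP wf).
  rewrite [b]surjective_pairing len_pair ltnS leq_add //.
  apply: leq_trans (@len_le_size _ _ _ (3 * len (W x)) _) _.
    apply/allP => s /wb /eqP ub; apply: leq_trans (len_unzip1 s) _.
    by rewrite ub leq_mul2l.
  rewrite ltnS leq_mul2r; apply/orP; right.
  by apply: leq_trans hNN; apply: (allP hN).
rewrite [y]surjective_pairing len_pair ltnS leq_add //.
  apply: leq_trans (@len_le_size _ _ _ (Lb x) _) _; first by apply/allP.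
  rewrite ltnS leq_mul2r; apply/orP; right; apply: leq_trans hs _.
  have : size s1 <= size (W x ++ W x) by rewrite sx size_cat leq_addr.
  by rewrite size_cat => /leq_trans; apply; rewrite addnn -mul2n leq_mul2l size_le_len.
rewrite -wd /config_word -[X in _ ++ X]cats0; exact: len_infix.
Qed.

Lemma polytime_best {X} {dX : data X} (S : X -> seq state) :
  polytime S -> polytime (fun x => best (S x)).
Proof.
move=> ptS; rewrite /best.
apply: (polytime_foldl (g := fun x acc s => if st_cost s < st_cost acc then s else acc)
  (M := fun x => len (S x) + len (@dflt state _))).
- by pt.
- by pt.
- by pt; apply: polytime_st_cost; pt.
- by have sb := polyb_len ptS; polyb.
move=> x s1 s2 sx.
apply: (@len_foldl_select state state _ (fun acc s => st_cost s < st_cost acc) id).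
  rewrite sx; case: (s1) => [|s t] /=.
    case: s2 {sx} => [|s t] /=; first exact: leq_addl.
    by rewrite len_cons; lia.
  by rewrite len_cons; lia.
pose proof (all_len (S x)) as h; move: h; rewrite {2}sx all_cat => /andP[+ _].
by apply: sub_all => s h; apply: leq_trans h (leq_addr _ _).
Qed.

Lemma polytime_start {X} {dX : data X} (s : X -> state) (j : X -> nat) :
  polytime s -> polytime j -> polytime (fun x => start (s x) (j x)).
Proof.
move=> pts ptj; rewrite /start /it_id /it_p /it_posE /it_posL; pt.
all: by [apply: (polytime_comp _ ptj); pt|apply: (polytime_comp _ pts); pt].
Qed.

Lemma polytime_solve : polytime solve.
Proof.
rewrite /solve; pt; apply: polytime_start; last by pt.
rewrite /solution /mk_items /mk_item; apply: polytime_best; pt.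
by apply: polytime_run; pt.
Qed.

(** * The precision in unary and the complete program *)

(** On an encoded instance [x.1] holds numerator and denominator of the tolerance, so this is the
    least integer exceeding its inverse. *)
Definition unary_size (x : raw_input) := x.1.2 %/ x.1.1 + 1.

(** The size includes the value of the counter, since the number of rounds may be exponential in its
    binary length. *)
Lemma polytime_unary : polytime_wrt (fun y : (nat * seq nat) * raw_input => len y + y.1.1)
  (fun y : (nat * seq nat) * raw_input => ((0, nseq y.1.1 0 ++ y.1.2), y.2)).
Proof.
pose f (y : (nat * seq nat) * raw_input) := ((y.1.1 - 1, 0 :: y.1.2), y.2).
have iterE k (y : (nat * seq nat) * raw_input) :
    iter k f y = ((y.1.1 - k, nseq k 0 ++ y.1.2), y.2).
  elim: k => [|k IH] /=; first by rewrite subn0; case: y => [[]].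
  by rewrite IH /f /= -subnDA addn1.
apply: (polytime_ext (f := fun y => iter y.1.1 f y)).
  by move=> y; rewrite iterE subnn.
apply: (@polytime_while _ _ _ (fun y => 0 < y.1.1) f _ (fun y => len y + 2 * y.1.1)).
- by move=> y; rewrite addn_gt0 len_gt0.
- by pt.
- by rewrite /f; pt.
- by move=> y k kn; rewrite iterE /= subn_gt0.
- by move=> y; rewrite iterE subnn.
- by exists 1 => y; rewrite expn1; lia.
- by exists 2 => y; rewrite expnS expn1; nia.
move=> [[n u] x] k /= kn; rewrite iterE !len_pair /=.
have : (len (nseq k 0 ++ u)) <= 2 * k + len u.
  have l0 : len 0 = 1 by [].
  by elim: k {kn} => [|k IH] //=; rewrite len_cons l0; lia.
have : len (n - k) <= len n by apply: len_mono; apply: leq_subr.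
by move: (len (n - k)) (len (nseq k 0 ++ u)) (len n) (len u) (len x) => *; lia.
Qed.

Lemma solve_program : exists A c, forall x : raw_input,
  exists2 t, exec A (enc x) (enc (solve (nseq (unary_size x) 0, x))) t &
    t <= (len x + unary_size x).+1 ^ c.
Proof.
have pt0 : polytime (fun x : raw_input => ((unary_size x, @nil nat), x)).
  by rewrite /unary_size; pt.
have pt2 : polytime (fun y : (nat * seq nat) * raw_input => solve (y.1.2, y.2)).
  by apply: (polytime_comp _ polytime_solve); pt.
have [p1 [T1 [Tb1 pT1]]] := polytime_unary.
have [w wb] := polyb_len polytime_unary.
have [e eb] := polyb_len pt0.
case: pt0 => p0 [T0 [[c0 Tb0] pT0]]; case: pt2 => p2 [T2 [[c2 Tb2] pT2]].
case: Tb1 => c1 Tb1.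
pose (sz (x : raw_input) := len x + unary_size x).
have sz0 x : 0 < sz x by rewrite addn_gt0 len_gt0.
(* [L0] bounds the data passed to the unary loop, [L1] those passed to [solve]. *)
pose (L0 x := (sz x).+1 ^ e).
pose (L1 x := (L0 x + sz x).+1 ^ w).
have [c cb] : polyb sz (fun x => sz x + (sz x).+1 ^ c0 + (L0 x + (L0 x + sz x).+1 ^ c1 + (L1 x).+1 ^ c2)).
  rewrite /L1 /L0; clear -sz0; clearbody sz; by polyb.
exists (PSeq p0 (PSeq p1 p2)), c => x.
have lsz : len x <= sz x by apply: leq_addr.
pose y0 := ((unary_size x, @nil nat), x).
have [t0 e0 l0] := pT0 x; have [t1 e1 l1] := pT1 y0.
have [t2 e2 l2] := pT2 ((0, nseq y0.1.1 0 ++ y0.1.2), y0.2).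
exists (len x + t0 + (value_len (enc y0) + t1 + t2)).
  rewrite -[nseq (unary_size x) 0]cats0; exact: exec_seq e0 (exec_seq e1 e2).
have h0 : len y0 <= L0 x.
  by apply: leq_trans (eb x) _; apply: leq_exp2; rewrite ltnS.
have hs : len y0 + y0.1.1 <= L0 x + sz x by rewrite leq_add // leq_addl.
have h1 : len ((0, nseq y0.1.1 0 ++ y0.1.2), y0.2) <= L1 x.
  by apply: leq_trans (wb y0) _; apply: leq_exp2; rewrite ltnS.
apply: leq_trans (cb x).
apply: leq_add; apply: leq_add => //.
- by apply: leq_trans l0 _; apply: leq_trans (Tb0 x) _; apply: leq_exp2; rewrite ltnS.
- apply: leq_add => //.
  by apply: leq_trans l1 _; apply: leq_trans (Tb1 y0) _; apply: leq_exp2; rewrite ltnS.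
by apply: leq_trans l2 _; apply: leq_trans (Tb2 _) _; apply: leq_exp2; rewrite ltnS.
Qed.

(** * Correctness of the greedy parsing *)

Definition convex (s : seq nat) :=
  forall x y z, x \in s -> z \in s -> x <= y -> y <= z -> y \in s.

Lemma convex_consecutive s : consecutive s -> convex s.
Proof.
case=> a /perm_mem h x y z; rewrite !h !mem_iota; lia.
Qed.

Lemma adjacentP u v : reflect (exists x y, [/\ x \in u, y \in v & x.+1 = y \/ y.+1 = x]) (adjacent u v).
Proof.
apply: (iffP hasP) => [[x xu /hasP[y yv /orP e]]|[x [y [xu yv e]]]].
  by exists x, y; split=> //; case: e => /eqP ->; [left|right].
exists x => //; apply/hasP; exists y => //.
by case: e => ->; rewrite eqxx ?orbT.
Qed.

Lemma adjacent_sym u v : adjacent u v = adjacent v u.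
Proof.
by apply/adjacentP/adjacentP => -[x [y [? ? e]]]; exists y, x; split=> //; case: e; [right|left|right|left].
Qed.

Lemma adjacent_sub u u' v v' : {subset u <= u'} -> {subset v <= v'} ->
  adjacent u v -> adjacent u' v'.
Proof.
move=> su sv /adjacentP[x [y [xu yv e]]]; apply/adjacentP.
by exists x, y; split=> //; [apply: su|apply: sv].
Qed.

Lemma convex_merge u v : convex u -> convex v -> adjacent u v -> convex (u ++ v).
Proof.
move=> cu cv /adjacentP[p [q [pu qv e]]] x y z; rewrite !mem_cat => xuv zuv xy yz.
have [yp|py] := leqP y p; have [yq|qy] := leqP y q.
- case/orP: xuv => xw; apply/orP.
    by left; apply: (cu x y p).
  by right; apply: (cv x y q).
- have ? : y = p by lia.
  by subst y; rewrite pu.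
- have ? : y = q by lia.
  by subst y; rewrite qv orbT.
case/orP: zuv => zw; apply/orP.
  by left; apply: (cu p y z) => //; lia.
by right; apply: (cv q y z) => //; lia.
Qed.

(** If some pair were ordered against the consecutive elements p and q, one of these would lie
    between two elements of the other set, against disjointness. *)
Lemma convex_adjacent_lt u v : convex u -> convex v ->
  (forall x, x \in u -> x \notin v) -> adjacent u v ->
  (forall x y, x \in u -> y \in v -> x < y) \/ (forall x y, x \in u -> y \in v -> y < x).
Proof.
move=> cu cv d /adjacentP[p [q [pu qv e]]].
have key x y : x \in u -> y \in v -> p < q -> x < y.
  move=> xu yv pq; rewrite ltnNge; apply/negP => yx.
  have [yp|py] := leqP y p.
    by have := d p pu; rewrite (cv y p q) // ltnW.
  have qu : q \in u by apply: (cu p q x) => //; lia.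
  by have := d q qu; rewrite qv.
have key' x y : x \in u -> y \in v -> q < p -> y < x.
  move=> xu yv pq; rewrite ltnNge; apply/negP => yx.
  have [py|yp] := leqP p y.
    by have := d p pu; rewrite (cv q p y) // ltnW.
  have qu : q \in u by apply: (cu x q p) => //; lia.
  by have := d q qu; rewrite qv.
case: e => e; [left|right] => x y xu yv; [apply: key|apply: key'] => //; lia.
Qed.

Lemma leaves_neq0 T : leaves T != [::].
Proof. by elim: T => [l|A hA B hB] //=; rewrite -size_eq0 size_cat addn_eq0 !size_eq0 negb_and hA. Qed.

(** The successor of the largest label of the lower sibling lies in the union by convexity, hence in
    the upper sibling. *)
Lemma sibling_adjacent A B : positive A B \/ negative A B ->
  consecutive (leaves A ++ leaves B) -> adjacent (leaves A) (leaves B).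
Proof.
have main (u v : seq nat) : u != [::] -> v != [::] ->
    (forall x y, x \in u -> y \in v -> x < y) -> convex (u ++ v) -> adjacent u v.
  move=> u0 v0 uv c.
  have [x xu xmax] : exists2 x, x \in u & forall y, y \in u -> y <= x.
    exists (\max_(y <- u) y).
      case: u u0 {uv c} => // a u _; elim: u a => [|b u IH] a.
        by rewrite big_seq1 mem_head.
      by rewrite big_cons; case: leqP => _; rewrite inE ?eqxx // IH orbT.
    by move=> y yu; apply: (@leq_bigmax_seq _ u xpredT id).
  have [y yv] : exists y, y \in v by case: v v0 {uv c} => // a v _; exists a; apply: mem_head.
  have xy := uv _ _ xu yv.
  have : x.+1 \in u ++ v by apply: (c x x.+1 y); rewrite ?mem_cat ?xu ?yv ?orbT.
  rewrite mem_cat => /orP[/xmax|xv]; first by rewrite ltnn.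
  by apply/adjacentP; exists x, x.+1; split=> //; left.
case=> h cons; have c := convex_consecutive cons.
  exact: main (leaves_neq0 A) (leaves_neq0 B) h c.
rewrite adjacent_sym; apply: main (leaves_neq0 B) (leaves_neq0 A) _ _.
  by move=> x y xB yA; apply: h.
by move=> x y z; rewrite !mem_cat ![(_ \in leaves B) || _]orbC -!mem_cat; apply: c.
Qed.

(** The cut between [u] and [v], later that at the root of a separating tree, falls between two
    segments or strictly inside one. *)
Lemma flatten_cat_split (T : eqType) (segs : seq (seq T)) (u v : seq T) :
  flatten segs = u ++ v ->
  (exists l r, [/\ segs = l ++ r, flatten l = u & flatten r = v]) \/
  (exists l p q r, [/\ segs = l ++ (p ++ q) :: r, p != [::], q != [::],
     flatten (rcons l p) = u & flatten (q :: r) = v]).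
Proof.
elim: segs u => [|s segs IH] u /=.
  by case: u => //= <-; left; exists [::], [::].
have [us|su] := leqP (size u) (size s).
  move=> E; have sE : s = u ++ drop (size u) s.
    rewrite -{1}(cat_take_drop (size u) s); congr (_ ++ _).
    by have := congr1 (take (size u)) E; rewrite takel_cat // take_size_cat.
  have vE : v = drop (size u) s ++ flatten segs.
    by have := congr1 (drop (size u)) E; rewrite (drop_size_cat v (erefl _)) {1}sE -catA drop_size_cat.
  have [u0|u0] := eqVneq u [::].
    by left; exists [::], (s :: segs); rewrite u0 /= E u0.
  have [d0|d0] := eqVneq (drop (size u) s) [::].
    left; exists [:: s], segs; split=> //=; first by rewrite cats0 sE d0 cats0.
    by rewrite vE d0.
  right; exists [::], u, (drop (size u) s), segs; split=> //=.
  - by rewrite -sE.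
  - by rewrite cats0.
move=> E; have uE : u = s ++ drop (size s) u.
  rewrite -{1}(cat_take_drop (size s) u); congr (_ ++ _).
  have := congr1 (take (size s)) E; rewrite take_size_cat // takel_cat //.
  exact: ltnW.
have : flatten segs = drop (size s) u ++ v.
  by move: E; rewrite {1}uE -catA => /eqP; rewrite eqseq_cat // eqxx => /eqP.
case/IH => [[l [r [-> lu rv]]]|[l [p [q [r [-> p0 q0 lu rv]]]]]].
  by left; exists (s :: l), r; split=> //=; rewrite lu -uE.
by right; exists (s :: l), p, q, r; split=> //=; rewrite lu -uE.
Qed.

Definition nonadjacent u v := ~~ adjacent u v.

(* In other words, the quotient of a separable permutation by a partition into
   intervals is separable again; an interval cut by the root of T leaves an
   interval on each side, so the induction applies to both subtrees. *)
Lemma separable_reduced T segs :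
  nodes_ok T -> flatten segs = leaves T ->
  (forall s, s \in segs -> s != [::] /\ convex s) ->
  sorted nonadjacent segs -> size segs <= 1.
Proof.
elim: T segs => [l|A IHA B IHB] segs.
  move=> _ E h _; have : size (flatten segs) = 1 by rewrite E.
  rewrite size_flatten; case: segs h {E} => [|s [|t segs]] //= h.
  have [s0 _] := h s (mem_head _ _).
  have [|t0 _] := h t; first by rewrite !inE eqxx orbT.
  by case: s s0 {h} => // ? ? _; case: t t0 => // ? ? _ /=; rewrite addSn addnS.
move=> [cons [pn okA okB]] /= /flatten_cat_split[].
  move=> [l [r [-> lA rB]]] h sor.
  have /andP[sl sr] : sorted nonadjacent l && sorted nonadjacent r.
    by move: sor; case: l {lA h} => //= x l; rewrite cat_path => /andP[-> /path_sorted ->].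
  have : size l <= 1 by apply: IHA => // s sl'; apply: h; rewrite mem_cat sl'.
  have : size r <= 1 by apply: IHB => // s sr'; apply: h; rewrite mem_cat sr' orbT.
  (* Neither side is empty, so two segments would remain, the label sets of the two siblings; these
     are adjacent, a contradiction. *)
  have := leaves_neq0 A; have := leaves_neq0 B; rewrite -lA -rB.
  case: l lA sor {h sl} => [|x [|? ?]] //= lA; case: r rB {sr} => [|y [|? ?]] //= rB.
  rewrite !cats0 in lA rB *; subst x y.
  by rewrite /= andbT /nonadjacent sibling_adjacent.
move=> [l [p [q [r [-> p0 q0 lA rB]]]]] h sor.
have [_ cpq] : p ++ q != [::] /\ convex (p ++ q).
  by apply: h; rewrite mem_cat mem_head orbT.
have dis x y : x \in p -> y \in q -> x < y \/ y < x.
  move=> xp yq.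
  have xA : x \in leaves A by rewrite -lA flatten_rcons mem_cat xp orbT.
  have yB : y \in leaves B by rewrite -rB /= mem_cat yq.
  by case: pn => pn; [left|right]; apply: pn.
have [cp cq] : convex p /\ convex q.
  have pqlt : (forall x y, x \in p -> y \in q -> x < y) \/ (forall x y, x \in p -> y \in q -> y < x).
    by case: pn => pn; [left|right] => x y xp yq; apply: pn;
      rewrite -?lA -?rB /= ?flatten_rcons mem_cat ?xp ?yq ?orbT.
  split=> x y z xs zs xy yz.
    have : y \in p ++ q by apply: (cpq x y z); rewrite ?mem_cat ?xs ?zs.
    rewrite mem_cat => /orP[//|yq].
    case: pqlt => lt; first by have := lt _ _ zs yq; lia.
    by have := lt _ _ xs yq; lia.
  have : y \in p ++ q by apply: (cpq x y z); rewrite ?mem_cat ?xs ?zs ?orbT.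
  rewrite mem_cat => /orP[yp|//].
  case: pqlt => lt; first by have := lt _ _ yp xs; lia.
  by have := lt _ _ yp zs; lia.
have sub_p u : nonadjacent u (p ++ q) -> nonadjacent u p.
  apply: contra; apply: adjacent_sub => // x; by rewrite mem_cat => ->.
have sub_q u : nonadjacent (p ++ q) u -> nonadjacent q u.
  apply: contra; apply: adjacent_sub => // x; by rewrite mem_cat orbC => ->.
have sA : sorted nonadjacent (rcons l p).
  move: sor; case: (l) => //= x l'; rewrite cat_path /= => /and3P[pl /sub_p pp _].
  by rewrite rcons_path pl.
have sB : sorted nonadjacent (q :: r).
  have : sorted nonadjacent ((p ++ q) :: r).
    by move: sor; case: (l) => //= x l'; rewrite cat_path /= => /and3P[].
  by case: (r) => //= x r' /andP[/sub_q -> ->].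
have : size (rcons l p) <= 1.
  apply: IHA => // s; rewrite mem_rcons inE => /predU1P[->//|sl].
  by apply: h; rewrite mem_cat sl.
have : size (q :: r) <= 1.
  apply: IHB => // s; rewrite inE => /predU1P[->//|sr].
  by apply: h; rewrite mem_cat inE sr !orbT.
by rewrite size_rcons size_cat /=; lia.
Qed.

Definition stopped (y : config) := y.2 = [::] /\
  forall b1 b2 st, y.1 = b2 :: b1 :: st -> ~~ adjacent (map it_posL b1.1) (map it_posL b2.1).

Lemma step_stopped K y : stopped y -> step K y = y.
Proof.
case: y => st r [/= r0 nadj]; case: stepP => [b1 b2 st' e|a r' e|//].
  by rewrite (negbTE (nadj _ _ _ e)).
by rewrite e in r0.
Qed.

(** The potential [2 * size y.2 + size y.1] drops by one at each shift and at each merge. *)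
Lemma iter_step_stopped K n y : 2 * size y.2 + size y.1 <= n -> stopped (iter n (step K) y).
Proof.
elim: n y => [|n IH] [st r] /=.
  by case: r => //; case: st.
rewrite -iterS iterSr.
have fixn z : stopped z -> stopped (iter n (step K) z).
  by move=> sz; elim: n {IH} => //= n IH; rewrite step_stopped.
case: stepP => [b1 b2 st' -> _|a r' -> _|r0 nadj] h.
- by apply: IH; move: h => /=; lia.
- by apply: IH; move: h => /=; lia.
by apply: fixn.
Qed.

(** * Approximation *)

Lemma sumE_cat h s t : sumE h (s ++ t) = sumE h s + sumE h t.
Proof. by rewrite /sumE big_cat. Qed.

Lemma sumL_cat h s t : sumL h (s ++ t) = sumL h s + sumL h t.
Proof. by rewrite /sumL big_cat. Qed.

(** The flags let one computation serve direct and skew nodes and both directions of the cross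
    pairs; with both flags false the sum vanishes. *)
Lemma cross_cost (e l : bool) (s t : state) :
  (forall a b, a \in s -> b \in t ->
     (it_posE a.1 < it_posE b.1) = e /\ (it_posL a.1 <= it_posL b.1) = l) ->
  \sum_(a <- s) \sum_(b <- t) pair_cost a b =
  e * (sumE it_wE s * sumE it_p t) + l * (sumL it_wL s * sumL it_p t).
Proof.
move=> h; rewrite /sumE /sumL !big_distrlr /=.
rewrite !(big_mkcond (fun a => _.2)) !(big_mkcond (fun a => ~~ _)) /=.
rewrite 2!big_distrr /= -big_split /=; apply: eq_big_seq => a As.
rewrite !(big_mkcond (fun b => _.2)) !(big_mkcond (fun b => ~~ _)) /=.
transitivity (\sum_(b <- t) ((if a.2 && b.2 then e * (it_wE a.1 * it_p b.1) else 0)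
    + (if ~~ a.2 && ~~ b.2 then l * (it_wL a.1 * it_p b.1) else 0))).
  apply: eq_big_seq => b bt; rewrite /pair_cost; have [-> ->] := h a b As bt.
  by rewrite !mulnbl; case: a.2; case: b.2; rewrite /= ?andbT ?andbF.
rewrite big_split /=; congr (_ + _).
  case: a.2; last by rewrite big1 // muln0.
  by rewrite big_distrr /=; apply: eq_bigr => b _; case: b.2; rewrite ?muln0.
case: a.2; first by rewrite big1 // muln0.
by rewrite big_distrr /=; apply: eq_bigr => b _; case: b.2; rewrite ?muln0.
Qed.

Definition before (h : item -> nat) (u v : seq item) :=
  forall a b, a \in u -> b \in v -> h a < h b.

Lemma mem_unzip1 (s : state) a : a \in s -> a.1 \in unzip1 s.
Proof. by move=> As; apply: map_f. Qed.

Lemma st_cost_cat_direct (s t : state) :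
  before it_posE (unzip1 s) (unzip1 t) -> before it_posL (unzip1 s) (unzip1 t) ->
  st_cost (s ++ t) = st_cost s + st_cost t
    + (sumE it_wE s * sumE it_p t + sumL it_wL s * sumL it_p t).
Proof.
move=> hE hL; rewrite /st_cost big_cat /=.
under eq_bigr => a _ do rewrite big_cat /=.
under [X in _ + X]eq_bigr => a _ do rewrite big_cat /=.
rewrite !big_split /= (@cross_cost true true s t); last first.
  move=> a b /mem_unzip1 As /mem_unzip1 bt; split; first exact: hE.
  exact/ltnW/hL.
rewrite (@cross_cost false false t s); last first.
  move=> a b /mem_unzip1 As /mem_unzip1 bt.
  have := hE _ _ bt As; have := hL _ _ bt As.
  by split; apply/negbTE; lia.
by rewrite !mul0n !mul1n; lia.
Qed.

Lemma st_cost_cat_skew (s t : state) :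
  before it_posE (unzip1 s) (unzip1 t) -> before it_posL (unzip1 t) (unzip1 s) ->
  st_cost (s ++ t) = st_cost s + st_cost t
    + (sumE it_wE s * sumE it_p t + sumL it_wL t * sumL it_p s).
Proof.
move=> hE hL; rewrite /st_cost big_cat /=.
under eq_bigr => a _ do rewrite big_cat /=.
under [X in _ + X]eq_bigr => a _ do rewrite big_cat /=.
rewrite !big_split /= (@cross_cost true false s t); last first.
  move=> a b /mem_unzip1 As /mem_unzip1 bt; split; first exact: hE.
  by have := hL _ _ bt As; lia.
rewrite (@cross_cost false true t s); last first.
  move=> a b /mem_unzip1 As /mem_unzip1 bt.
  have := hE _ _ bt As; have := hL _ _ As bt.
  by split; lia.
by rewrite !mul0n !mul1n; lia.
Qed.

(** * Propagation of the approximation error *)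

Section Near.
Variables (R : realFieldType) (K : nat).
Hypothesis K_gt0 : 0 < K.
Local Open Scope ring_scope.

Definition growth : R := 1 + K%:R^-1.

Lemma growth_ge1 : 1 <= growth.
Proof. by rewrite lerDl invr_ge0 ler0n. Qed.

Lemma growth_ge0 : 0 <= growth.
Proof. exact: le_trans ler01 growth_ge1. Qed.

Lemma approx_le_growth m n : approx_le K m n -> m%:R <= growth * n%:R.
Proof.
rewrite /approx_le -(ler_nat R) !natrM => h.
have K0 : 0 < K%:R :> R by rewrite ltr0n.
rewrite -(ler_pM2l K0); apply: le_trans h _.
by rewrite mulrA mulrDr mulr1 divff ?gt_eqF // -natr1.
Qed.

Definition near_le e (m n : nat) : Prop := m%:R <= growth ^+ e * n%:R :> R.

Lemma near_le_refl e m : near_le e m m.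
Proof. by rewrite /near_le ler_peMl // ?ler0n // exprn_ege1 // growth_ge1. Qed.

Lemma near_le_add e m n m' n' : near_le e m n -> near_le e m' n' ->
  near_le e (m + m')%N (n + n')%N.
Proof. by rewrite /near_le !natrD mulrDr; apply: lerD. Qed.

Lemma near_le_mul e m n m' n' : near_le e m n -> near_le e m' n' ->
  near_le (2 * e) (m * m')%N (n * n')%N.
Proof.
move=> h h'; rewrite /near_le !natrM mul2n -addnn exprD mulrACA.
by apply: ler_pM => //; rewrite ler0n.
Qed.

Lemma near_le_mono e e' m n : (e <= e')%N -> near_le e m n -> near_le e' m n.
Proof.
move=> ee; rewrite /near_le => /le_trans; apply; rewrite ler_wpM2r ?ler0n //.
by rewrite ler_weXn2l // growth_ge1.
Qed.

Lemma near_le_approx e m n k : approx_le K m n -> near_le e n k -> near_le e.+1 m k.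
Proof.
move=> /approx_le_growth h; rewrite /near_le exprS -mulrA => h'.
by apply: le_trans h _; rewrite ler_wpM2l // growth_ge0.
Qed.

(** The cost carries the double exponent because it contains products of two sums. *)
Definition near e (t s : state) : Prop :=
  [/\ near_le e (sumE it_p t) (sumE it_p s), near_le e (sumL it_p t) (sumL it_p s),
      near_le e (sumE it_wE t) (sumE it_wE s), near_le e (sumL it_wL t) (sumL it_wL s)
    & near_le (2 * e) (st_cost t) (st_cost s)].

Lemma near_refl e s : near e s s.
Proof. by split; apply: near_le_refl. Qed.

Lemma near_mono e e' t s : (e <= e')%N -> near e t s -> near e' t s.
Proof.
move=> ee [h1 h2 h3 h4 h5]; split; try exact: (near_le_mono ee).
by apply: near_le_mono h5; rewrite leq_mul2l.
Qed.

Lemma near_dominates e u t s : dominates K u t -> near e t s -> near e.+1 u s.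
Proof.
case/and5P=> a1 a2 a3 a4 a5 [h1 h2 h3 h4 h5].
split; [exact: near_le_approx a1 h1|exact: near_le_approx a2 h2|
  exact: near_le_approx a3 h3|exact: near_le_approx a4 h4|].
apply: (@near_le_mono (2 * e).+1); first by lia.
exact: near_le_approx a5 h5.
Qed.

(** Concatenation leaves the exponent unchanged, so only trimming loses accuracy. *)
Lemma near_cat e s s' t t' :
  unzip1 s = unzip1 s' -> unzip1 t = unzip1 t' ->
  before it_posE (unzip1 s) (unzip1 t) ->
  before it_posL (unzip1 s) (unzip1 t) \/ before it_posL (unzip1 t) (unzip1 s) ->
  near e s s' -> near e t t' -> near e (s ++ t) (s' ++ t').
Proof.
move=> us ut hE hL [h1 h2 h3 h4 h5] [k1 k2 k3 k4 k5].
split; rewrite ?sumE_cat ?sumL_cat; try exact: near_le_add.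
case: hL => hL.
  rewrite !st_cost_cat_direct -?us -?ut //.
  by repeat apply: near_le_add => //; apply: near_le_mul.
rewrite !st_cost_cat_skew -?us -?ut //.
by repeat apply: near_le_add => //; apply: near_le_mul.
Qed.

(** Taking the number of jobs as exponent makes the guarantee independent of the order in which the
    parser merges. *)
Definition block_ok (b : block) : Prop :=
  [/\ b.1 != [::], block_wf b, convex (map it_posL b.1) &
    forall s, unzip1 s = b.1 -> exists2 t, t \in b.2 & near (size b.1) t s].

Lemma leaf_block_ok a : block_ok (leaf_block a).
Proof.
split=> //=; first by rewrite /block_wf /= eqxx.
  by move=> x y z; rewrite !inE => /eqP-> /eqP-> ? ?; rewrite eqn_leq; apply/andP.
move=> [|[a' c] [|? ?]] //= [->]; exists [:: (a, c)]; last exact: near_refl.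
by case: c; rewrite !inE eqxx ?orbT.
Qed.

Lemma merge_ok b1 b2 : block_ok b1 -> block_ok b2 ->
  adjacent (map it_posL b1.1) (map it_posL b2.1) ->
  before it_posE b1.1 b2.1 -> uniq (map it_posL (b1.1 ++ b2.1)) ->
  block_ok (merge_blocks K b1 b2).
Proof.
move=> [n1 w1 c1 a1] [n2 w2 c2 a2] adj hE u.
have hL : before it_posL b1.1 b2.1 \/ before it_posL b2.1 b1.1.
  have dis x : x \in map it_posL b1.1 -> x \notin map it_posL b2.1.
    move: u; rewrite map_cat cat_uniq => /and3P[_ /hasPn h _] x1.
    by apply/negP => /h /=; rewrite x1.
  case: (convex_adjacent_lt c1 c2 dis adj) => h; [left|right] => a b ab bb.
    by apply: h; apply: map_f.
  by apply: h; apply: map_f.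
split; first by rewrite -size_eq0 size_cat addn_eq0 negb_and size_eq0 n1.
- exact: merge_wf.
- by rewrite map_cat; apply: convex_merge.
move=> s us.
have E1 : unzip1 (take (size b1.1) s) = b1.1.
  by rewrite /unzip1 map_take [map _ _]us /= take_size_cat.
have E2 : unzip1 (drop (size b1.1) s) = b2.1.
  by rewrite /unzip1 map_drop [map _ _]us /= drop_size_cat.
have [t1 m1 k1] := a1 _ E1; have [t2 m2 k2] := a2 _ E2.
have v1 := eqP (allP w1 _ m1); have v2 := eqP (allP w2 _ m2).
have s1 : (0 < size b1.1)%N by rewrite lt0n size_eq0.
have s2 : (0 < size b2.1)%N by rewrite lt0n size_eq0.
(* Both sizes are positive, so each is at most the sum minus 1; this leaves room for the factor lost
   by trimming. *)
have : near (size b1.1 + size b2.1).-1 (t1 ++ t2) s.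
  rewrite -(cat_take_drop (size b1.1) s); apply: near_cat.
  - by rewrite E1.
  - by rewrite E2.
  - by rewrite v1 v2.
  - by rewrite v1 v2.
  - by apply: near_mono k1; lia.
  - by apply: near_mono k2; lia.
move=> h.
have [|t tm td] := @trim_dominates K (flatten [seq [seq s ++ t | t <- b2.2] | s <- b1.2]) (t1 ++ t2).
  by apply/flattenP; exists [seq t1 ++ t | t <- b2.2]; [apply/mapP; exists t1|apply/mapP; exists t2].
exists t => //; have := near_dominates td h.
by rewrite /= size_cat prednK // addn_gt0 s1.
Qed.

Variable W : seq item.
Hypothesis W_posE : sorted ltn (map it_posE W).
Hypothesis W_posL : uniq (map it_posL W).

Lemma infix_before (X Y u v : seq item) : W = X ++ u ++ v ++ Y -> before it_posE u v.
Proof.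
move=> E; move: W_posE; rewrite (sorted_pairwise ltn_trans) E !map_cat.
rewrite pairwise_cat => /and3P[_ _].
rewrite pairwise_cat allrel_catr => /and3P[/andP[h _] _ _] a b au bv.
by apply: (allrelP h); apply: map_f.
Qed.

Lemma infix_uniq (X Y u : seq item) : W = X ++ u ++ Y -> uniq (map it_posL u).
Proof.
by move=> E; move: W_posL; rewrite E !map_cat !cat_uniq => /and3P[_ _ /and3P[-> _ _]].
Qed.

(** The topmost pair is excepted because a shift or a merge has just created it; a shift happens
    only after that pair has been found nonadjacent. *)
Definition config_ok (y : config) : Prop :=
  [/\ config_word y = W, forall b, b \in y.1 -> block_ok b &
    sorted nonadjacent [seq map it_posL b.1 | b <- behead y.1]].

Lemma step_ok y : config_ok y -> config_ok (step K y).
Proof.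
move=> [wd ok sor]; split; first by rewrite step_word.
  move: wd ok; case: y {sor} => st r; case: stepP => [b1 b2 st' -> adj|a r' -> _|_ _] //= wd ok.
    move=> b; rewrite inE => /predU1P[->|bst]; last by apply: ok; rewrite !inE bst !orbT.
    have E : W = flatten (rev (map fst st')) ++ b1.1 ++ b2.1 ++ r.
      by rewrite -wd /config_word /= !rev_cons -!cats1 !flatten_cat /= !cats0 -!catA.
    apply: merge_ok => //; try by apply: ok; rewrite !inE eqxx ?orbT.
      exact: infix_before E.
    by apply: (@infix_uniq (flatten (rev (map fst st'))) r); rewrite -catA.
  move=> b; rewrite inE => /predU1P[->|]; last exact: ok.
  exact: leaf_block_ok.
case: y {wd ok} sor => st r; case: stepP => [b1 b2 st' -> adj|a r' _ nadj|_ _] //=.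
  by move/path_sorted.
case: st nadj => [|b2 [|b1 st']] //= nadj ->.
by rewrite andbT /nonadjacent adjacent_sym (nadj _ _ _ erefl).
Qed.

Lemma run_ok m : scale m W = K -> separable (map it_posL W) ->
  exists2 b, run m W = ([:: b], [::]) & b.1 = W /\ block_ok b.
Proof.
move=> mK [T [TW Tok]].
have runE : run m W = iter (size (W ++ W)) (step K) ([::], W).
  rewrite /run mK; elim: (W ++ W) ([::], W) => [|a l IH] y //=.
  by rewrite IH -iterS iterSr.
have [r0 nadj] : stopped (run m W).
  by rewrite runE; apply: iter_step_stopped; rewrite size_cat /=; lia.
have [wd ok sor] : config_ok (run m W).
  rewrite runE; elim: (size _) => [|n IH]; first by split.
  by rewrite iterS; apply: step_ok.
case: (run m W) r0 nadj wd ok sor => st r /= -> nadj wd ok sor.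
pose lab (b : block) := map it_posL b.1.
have {}sor : sorted nonadjacent (map lab st).
  case: st nadj sor {wd ok} => [|b2 [|b1 st]] //= nadj ->.
  by rewrite andbT /nonadjacent adjacent_sym (nadj _ _ _ erefl).
have st1 : (size st <= 1)%N.
  rewrite -(size_map lab) -size_rev; apply: (separable_reduced Tok).
  - rewrite TW -wd /config_word cats0 map_flatten map_rev -map_comp //.
  - move=> s; rewrite mem_rev => /mapP[b /ok[n _ c _] ->]; split=> //.
    by rewrite -size_eq0 size_map size_eq0.
  rewrite rev_sorted; case: (map lab st) sor => //= x l.
  by apply: sub_path => u v; rewrite /nonadjacent adjacent_sym.
case: st st1 wd ok {nadj sor} => [|b [|? ?]] //= _ wd ok.
  by have := leaves_neq0 T; rewrite TW -wd.
exists b => //; split; first by rewrite -wd /config_word /= !cats0.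
by apply: ok; apply: mem_head.
Qed.

Lemma best_mem (S : seq state) : S != [::] ->
  best S \in S /\ forall s, s \in S -> (st_cost (best S) <= st_cost s)%N.
Proof.
move=> S0; rewrite /best.
have main (u : seq state) z : let t := foldl (fun acc s => if (st_cost s < st_cost acc)%N then s else acc) z u in
    t \in z :: u /\ forall s, s \in z :: u -> (st_cost t <= st_cost s)%N.
  elim: u z => [|a u IH] z /=.
    by rewrite mem_head; split=> // s; rewrite inE => /eqP ->.
  case: (IH (if (st_cost a < st_cost z)%N then a else z)) => m h; split.
    move: m; rewrite !inE => /orP[/eqP ->|->]; last by rewrite !orbT.
    by case: ifP => _; rewrite eqxx ?orbT.
  move=> s; rewrite !inE => /or3P[/eqP ->|/eqP ->|su].
  - by apply: leq_trans (h _ (mem_head _ _)) _; case: ifP => // /ltnW.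
  - by apply: leq_trans (h _ (mem_head _ _)) _; case: ifP => // /negbT; rewrite -leqNgt.
  - by apply: h; rewrite inE su orbT.
case: S S0 => //= a u _; rewrite ltnn; exact: main.
Qed.

Lemma solution_near m : scale m W = K -> separable (map it_posL W) ->
  let t := best (head dflt (run m W).1).2 in
  unzip1 t = W /\
  forall s, unzip1 s = W -> (st_cost t)%:R <= growth ^+ (2 * size W) * (st_cost s)%:R :> R.
Proof.
move=> mK sep /=; have [b -> [bW [b0 wf _ ap]]] := run_ok mK sep.
have [|tb tmin] := @best_mem b.2.
  have [|t tb _] := ap [seq (a, true) | a <- b.1]; last by case: (b.2) tb.
  by rewrite /unzip1 -map_comp map_id.
split; first by rewrite -bW; apply/eqP; apply: (allP wf).
move=> s sW; have [|t tb' [_ _ _ _ h]] := ap s; first by rewrite bW.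
rewrite -bW; apply: le_trans h; rewrite ler_nat; exact: tmin.
Qed.

End Near.

(** * Schedules and partitions *)

Section Partition.
Variables (n : nat) (p wE wL : 'I_n -> nat).

(* [rE i j] and [rL i j] say that i lies farther from the due date than j. *)
Definition partition_cost (rE rL : rel 'I_n) (E : pred 'I_n) : nat :=
  \sum_i \sum_j ((if [&& E i, E j & rE i j] then wE i * p j else 0) +
                 (if [&& ~~ E i, ~~ E j & rL i j || (i == j)] then wL i * p j else 0)).

(** This is the exchange argument of Smith's rule, done for all pairs at once: where [r2] lacks a
    pair of [r1], it has the reversed pair by totality, and that one costs at least as much. *)
Lemma exchange_le (f : 'I_n -> 'I_n -> nat) (P : pred 'I_n) (r1 r2 : rel 'I_n) :
  (forall i j, r1 i j -> ~~ r1 j i /\ f i j <= f j i) ->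
  (forall i j, i != j -> r2 i j || r2 j i) ->
  \sum_i \sum_j (if [&& P i, P j & r1 i j] then f i j else 0) <=
  \sum_i \sum_j (if [&& P i, P j & r2 i j] then f i j else 0).
Proof.
move=> h1 h2.
pose A := \sum_i \sum_j (if [&& P i, P j & r1 i j && r2 i j] then f i j else 0).
pose B := \sum_i \sum_j (if [&& P i, P j & ~~ r1 i j && r2 i j] then f i j else 0).
have -> : \sum_i \sum_j (if [&& P i, P j & r2 i j] then f i j else 0) = A + B.
  rewrite /A /B -big_split; apply: eq_bigr => i _; rewrite -big_split.
  by apply: eq_bigr => j _ /=; case: (P i); case: (P j); case: (r1 i j); case: (r2 i j);
     rewrite /= ?addn0 ?add0n.
rewrite /B [X in _ <= _ + X]exchange_big /A -big_split; apply: leq_sum => i _.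
rewrite -big_split; apply: leq_sum => j _ /=.
case: (P i); case: (P j) => //=; case: (boolP (r1 i j)) => //= r1ij.
have [r1ji fle] := h1 _ _ r1ij; rewrite r1ji /=.
case: (boolP (r2 i j)) => r2ij; first by rewrite leq_addr.
have ij : i != j by apply/eqP => ij; move: r1ij r1ji; rewrite ij => ->.
by have := h2 _ _ ij; rewrite (negbTE r2ij) /= => ->.
Qed.

Lemma partition_cost_le (rE rL sE sL : rel 'I_n) (E : pred 'I_n) :
  (forall i j, rE i j -> ~~ rE j i /\ wE i * p j <= wE j * p i) ->
  (forall i j, rL i j -> ~~ rL j i /\ wL i * p j <= wL j * p i) ->
  (forall i j, i != j -> sE i j || sE j i) ->
  (forall i j, i != j -> sL i j || sL j i) -> irreflexive sL ->
  partition_cost rE rL E <= partition_cost sE sL E.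
Proof.
move=> hE hL tE tL iL; rewrite /partition_cost.
(* The own processing times of the tardy jobs contribute equally on both sides and are set apart. *)
have split_diag (r : rel 'I_n) : irreflexive r ->
    \sum_i \sum_j (if [&& ~~ E i, ~~ E j & r i j || (i == j)] then wL i * p j else 0) =
    \sum_i \sum_j (if [&& ~~ E i, ~~ E j & r i j] then wL i * p j else 0) +
    \sum_i \sum_j (if [&& ~~ E i, ~~ E j & i == j] then wL i * p j else 0).
  move=> ir; rewrite -big_split; apply: eq_bigr => i _; rewrite -big_split.
  apply: eq_bigr => j _ /=; case: eqP => [<-|_]; first by rewrite ir !andbF /= add0n.
  by rewrite orbF !andbF addn0.
have irL : irreflexive rL by move=> i; apply/negP => r; have [] := hL i i r; rewrite r.
under eq_bigr do rewrite big_split; under [X in _ <= X]eq_bigr do rewrite big_split.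
rewrite !big_split /= !split_diag //.
apply: leq_add; first exact: exchange_le.
by rewrite leq_add2r; apply: exchange_le.
Qed.

End Partition.

Section Packing.
Variable R : realFieldType.
Local Open Scope ring_scope.

(** Induction by removing the interval with the latest start: all others end before that start. *)
Lemma packing (T : finType) (P : pred T) (a q : T -> R) x y :
  x <= y -> (forall i, P i -> [/\ 0 < q i, x <= a i & a i + q i <= y]) ->
  (forall i j, P i -> P j -> i != j -> a i + q i <= a j \/ a j + q j <= a i) ->
  \sum_(i | P i) q i <= y - x.
Proof.
elim: {P}#|P| {-2}P (erefl #|P|) y => [|k IH] P cP y xy hP dP.
  rewrite big_pred0 ?subr_ge0 // => i; exact: (card0_eq cP).
have /card_gt0P[i0 Pi0] : (0 < #|P|)%N by rewrite cP.
have [i Pi imax] := @arg_maxP _ _ _ i0 P a Pi0.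
rewrite (bigD1 i) //=; have [qi xi iy] := hP i Pi.
have : \sum_(j | P j && (j != i)) q j <= a i - x.
  apply: IH => //.
  - have iP : i \in P by [].
    by move: cP; rewrite (cardD1 i) iP add1n => -[<-]; apply: eq_card => j; rewrite !inE andbC.
  - move=> j /andP[Pj ji]; have [qj xj _] := hP j Pj; split=> //.
    case: (dP j i Pj Pi ji) => // h; have h' : a j <= a i := imax j Pj; lra.
  by move=> j j' /andP[Pj _] /andP[Pj' _]; apply: dP.
by lra.
Qed.

End Packing.

(** * Lower bound for an arbitrary schedule *)

Section LowerBound.
Variables (R : realType) (I : awet) (S : 'I_(njobs I) -> R).
Hypothesis S_feas : feasible S.
Local Open Scope ring_scope.
Notation p := (@ptime I).
Let d : R := (due_date I)%:R.
Let C j : R := S j + (p j)%:R.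
(** [E1] and [E2] differ at most in a job being processed at d, which is tardy for the former and
    early for the latter. *)
Let E1 j := C j <= d.
Let E2 j := S j < d.

Lemma feasible_disjoint i j : i != j -> C i <= S j \/ C j <= S i.
Proof.
move=> ij; have [h0 h] := S_feas.
have pi : (0 : R) < (p i)%:R by rewrite ltr0n ptime_gt0.
have pj : (0 : R) < (p j)%:R by rewrite ltr0n ptime_gt0.
have [ji|ji] := leP (C i) (S j); first by left.
have [ij'|ij'] := leP (C j) (S i); first by right.
exfalso; have := h i j (Num.max (S i) (S j)) ij.
rewrite !in_itv /= => H; have : ~~ (S j <= Num.max (S i) (S j) < S j + (p j)%:R).
  apply: H; rewrite le_max lexx /= gt_max /C in ji ij' *; apply/andP; split=> //; lra.
rewrite /C in ji ij'.
by rewrite le_max lexx orbT /= gt_max ij' /= ltrDl pj.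
Qed.

Let p_gt0 j : (0 : R) < (p j)%:R. Proof. by rewrite ltr0n ptime_gt0. Qed.

Let start_lt i j : i != j -> S i < S j -> C i <= S j.
Proof.
move=> ij lt; have [//|h] := feasible_disjoint ij.
by have := p_gt0 j; rewrite /C in h *; lra.
Qed.

(* The fraction of the job in process at the due date which precedes it; the
   cost is bounded below by the corresponding convex combination of the costs
   of the two partitions in which that job is tardy or early. *)
Lemma straddling_fraction : exists2 th : R, 0 <= th <= 1 &
  forall j, E2 j -> ~~ E1 j -> th * (p j)%:R = d - S j.
Proof.
case: (pickP (fun j => E2 j && ~~ E1 j)) => [s /andP[s2 s1]|none]; last first.
  by exists 0; rewrite ?lexx ?ler01 // => j j2 j1; have := none j; rewrite j2 j1.
have ps := p_gt0 s; move: s1 s2; rewrite /E1 /E2 -ltNge => s1 s2.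
exists ((d - S s) / (p s)%:R).
  apply/andP; split; first by rewrite divr_ge0 // ?ltW // subr_gt0.
  by rewrite ler_pdivrMr // mul1r; rewrite /C in s1; lra.
move=> j j2; rewrite -ltNge => j1; have [->|js] := eqVneq j s.
  by rewrite divfK // gt_eqF.
by case: (feasible_disjoint js); rewrite /C in s1 j1 *; lra.
Qed.

(** Both partitions keep the order of the start times; the passage to the order by ratios is left to
    [partition_cost_le]. *)
Lemma cost_lower_bound :
  exists2 th : R, 0 <= th <= 1 &
  (1 - th) * (partition_cost p (@wE I) (@wL I) (fun i j => S i < S j) (fun i j => S j < S i) E1)%:R
  + th * (partition_cost p (@wE I) (@wL I) (fun i j => S i < S j) (fun i j => S j < S i) E2)%:R
  <= cost S.
Proof.
have [th th01 hth] := straddling_fraction; exists th => //.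
have /andP[th0 th1] := th01.
have E12 j : E1 j -> E2 j by rewrite /E1 /E2 /C; have := p_gt0 j; lra.
(* By the choice of [th] these are the amounts of job [i] processed before and after d. *)
pose e i : R := (1 - th) * (if E1 i then (p i)%:R else 0) + th * (if E2 i then (p i)%:R else 0).
pose l i : R := (1 - th) * (if E1 i then 0 else (p i)%:R) + th * (if E2 i then 0 else (p i)%:R).
(* The parts before d of the jobs started after [j] are disjoint and lie between [C j] and d. *)
have early j : E1 j -> \sum_(i | S j < S i) e i <= d - C j.
  move=> j1; have -> : \sum_(i | S j < S i) e i = \sum_(i | (S j < S i) && E2 i) e i.
    rewrite [RHS]big_mkcondr; apply: eq_bigr => i _; case: ifPn => // i2.
    rewrite /e (negbTE i2) (contraNF (@E12 i) i2); lra.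
  apply: (packing (a := S)) => //.
    move=> i /andP[ji i2]; have pi := p_gt0 i.
    have Cj : C j <= S i by apply: start_lt => //; apply: contraTneq ji => ->; rewrite ltxx.
    rewrite /e i2; case: ifPn => i1; first by split=> //; [lra|rewrite /E1 /C in i1; lra].
    have := hth i i2 i1; rewrite /E2 in i2; rewrite mulr0 add0r => h; split=> //; lra.
  move=> i k /andP[_ i2] /andP[_ k2] ik.
  have eC i0 : e i0 <= (p i0)%:R.
    by rewrite /e; have := p_gt0 i0; case: ifP => _; case: ifP => _; nra.
  by have := eC i; have := eC k; case: (feasible_disjoint ik); rewrite /C => ? ? ?; [left|right]; lra.
(* Mirror image: the part after d is measured backwards from the completion time. *)
have late j : ~~ E1 j -> \sum_(i | (S i < S j) || (j == i)) l i <= C j - d.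
  move=> j1; have -> : \sum_(i | (S i < S j) || (j == i)) l i =
      \sum_(i | ((S i < S j) || (j == i)) && ~~ E1 i) l i.
    rewrite [RHS]big_mkcondr; apply: eq_bigr => i _; case: ifPn => // /negPn i1.
    rewrite /l i1 (E12 _ i1); lra.
  have lE i : ~~ E1 i -> [/\ 0 < l i, l i <= (p i)%:R & d <= C i - l i].
    move=> i1; have pi := p_gt0 i; rewrite /l (negbTE i1).
    case: ifPn => i2.
      have h := hth i i2 i1; rewrite /E1 /C -ltNge in i1; rewrite /C /E2 in i2 *; split; lra.
    by rewrite /E2 -leNgt in i2; rewrite /C; split; lra.
  apply: (packing (a := fun i => C i - l i)).
  - by rewrite /E1 -ltNge in j1; exact: ltW.
  - move=> i /andP[ij i1]; have [l0 lp dl] := lE i i1; split=> //.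
    rewrite subrK; case/orP: ij => [ij|/eqP -> //].
    have : C i <= S j by apply: start_lt => //; apply: contraTneq ij => ->; rewrite ltxx.
    by have := p_gt0 j; rewrite /C; lra.
  move=> i k /andP[_ i1] /andP[_ k1] ik; rewrite !subrK.
  have [_ li _] := lE i i1; have [_ lk _] := lE k k1.
  by case: (feasible_disjoint ik); rewrite /C => ?; [left|right]; lra.
rewrite /partition_cost !natr_sum !mulr_sumr -big_split /=.
apply: ler_sum => j _.
have dE : (\sum_i (p i)%:R : R) = d by rewrite -natr_sum.
rewrite !natr_sum dE -/(C j) !mulr_sumr -big_split /=.
have wE0 : (0 : R) <= (wE j)%:R by rewrite ler0n.
have wL0 : (0 : R) <= (wL j)%:R by rewrite ler0n.
case: (boolP (E1 j)) => j1.
  have j2 := E12 j j1; rewrite j2 /=.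
  have Cd : C j <= d by exact: j1.
  rewrite (max_idPl _) ?subr_ge0 // (max_idPr _) ?subr_le0 // mulr0 addr0.
  apply: (le_trans _ (ler_wpM2l wE0 (early j j1))); rewrite mulr_sumr [leRHS]big_mkcond /=.
  apply: ler_sum => i _; rewrite /e.
  by case: (E1 i); case: (E2 i); case: (S j < S i); rewrite /= ?addn0 ?natrM; lra.
have Cd : d <= C j by apply: ltW; move: j1; rewrite /E1 -ltNge.
rewrite (max_idPr _) ?subr_le0 // (max_idPl _) ?subr_ge0 // mulr0 add0r /=.
apply: (le_trans _ (ler_wpM2l wL0 (late j j1))); rewrite mulr_sumr [leRHS]big_mkcond /=.
apply: ler_sum => i _.
(* As [j] completes after d, no job started after it starts before d; so if [j] straddles d, it has
   no earliness cost when counted as early. *)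
have -> : [&& E2 j, E2 i & S j < S i] = false.
  apply/negP => /and3P[_ i2 ji]; rewrite /E2 in i2.
  have : C j <= S i by apply: start_lt => //; apply: contraTneq ji => ->; rewrite ltxx.
  by rewrite leNgt (lt_le_trans i2 Cd).
have pw : 0 <= (wL j)%:R * (p i)%:R :> R by rewrite mulr_ge0 // ler0n.
have thpw : 0 <= th * ((wL j)%:R * (p i)%:R) by rewrite mulr_ge0.
have thpw1 : 0 <= (1 - th) * ((wL j)%:R * (p i)%:R) by rewrite mulr_ge0 // subr_ge0.
rewrite /l; case: (E1 i); case: (E2 i); case: (E2 j); case: (_ || _);
  rewrite /= ?addn0 ?add0n ?natrM; lra.
Qed.

End LowerBound.

(** * The schedule realizing a partition *)

Section PartitionSchedule.
Variables (R : realType) (I : awet) (E : pred 'I_(njobs I)) (posE posL : 'I_(njobs I) -> nat).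
Hypotheses (posE_inj : injective posE) (posL_inj : injective posL).
Notation p := (@ptime I).

(** The early jobs have total length at most the due date, so the truncated subtraction is exact and
    start times are nonnegative. *)
Definition partition_start (j : 'I_(njobs I)) : nat :=
  if E j then due_date I - \sum_(i | E i && (posE j <= posE i)) p i
  else due_date I + \sum_(i | ~~ E i && (posL j < posL i)) p i.

Let early_le (P : pred 'I_(njobs I)) : \sum_(i | P i) p i <= due_date I.
Proof. by rewrite /due_date [X in _ <= X](bigID P) /= leq_addr. Qed.

Let early_end j : E j ->
  partition_start j + p j = due_date I - \sum_(i | E i && (posE j < posE i)) p i.
Proof.
move=> Ej; rewrite /partition_start Ej.
have e : \sum_(i | E i && (posE j <= posE i)) p i = p j + \sum_(i | E i && (posE j < posE i)) p i.
  rewrite (bigD1 j) ?Ej ?leqnn //=; congr (_ + _); apply: eq_bigl => i.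
  rewrite -andbA; congr (_ && _); rewrite ltn_neqAle andbC; congr (_ && _).
  by rewrite (inj_eq posE_inj) eq_sym.
have := early_le (fun i => E i && (posE j <= posE i)); rewrite e; lia.
Qed.

Let late_end j : ~~ E j ->
  partition_start j + p j = due_date I + \sum_(i | ~~ E i && (posL j <= posL i)) p i.
Proof.
move=> Ej; rewrite /partition_start (negbTE Ej).
rewrite [in RHS](bigD1 j) ?Ej ?leqnn //= -addnA [_ + p j]addnC.
congr (_ + (_ + _)); apply: eq_bigl => i.
rewrite -andbA; congr (_ && _); rewrite ltn_neqAle andbC; congr (_ && _).
by rewrite (inj_eq posL_inj) eq_sym.
Qed.

Let sub_sum (P Q : pred 'I_(njobs I)) : (forall i, P i -> Q i) ->
  \sum_(i | P i) p i <= \sum_(i | Q i) p i.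
Proof.
move=> PQ; rewrite [X in _ <= X](bigID P) /=.
rewrite [X in _ <= X + _](eq_bigl P) ?leq_addr // => i; apply: andb_idl; exact: PQ.
Qed.

Lemma partition_start_disjoint i j : i != j ->
  partition_start i + p i <= partition_start j \/ partition_start j + p j <= partition_start i.
Proof.
have main k l : k != l ->
    [|| E k && ~~ E l, [&& E k, E l & posE k < posE l] | [&& ~~ E k, ~~ E l & posL l < posL k]] ->
    partition_start k + p k <= partition_start l.
  move=> kl /or3P[/andP[Ek El]|/and3P[Ek El lt]|/and3P[Ek El lt]].
  - rewrite early_end // /partition_start (negbTE El).
    by apply: leq_trans (leq_subr _ _) (leq_addr _ _).
  - rewrite early_end // /partition_start El; apply: leq_sub2l; apply: sub_sum => x.
    by move=> /andP[-> h] /=; apply: leq_trans lt h.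
  - rewrite late_end // /partition_start (negbTE El) leq_add2l; apply: sub_sum => x.
    by move=> /andP[-> h] /=; apply: leq_trans lt h.
move=> ij; have ji : j != i by rewrite eq_sym.
have nE : posE i != posE j by rewrite (inj_eq posE_inj).
have nL : posL i != posL j by rewrite (inj_eq posL_inj).
case Ei : (E i); case Ej : (E j).
- by move: nE; rewrite neq_ltn => /orP[h|h]; [left|right]; apply: main; rewrite ?Ei ?Ej ?h ?orbT.
- by left; apply: main; rewrite ?Ei ?Ej.
- by right; apply: main; rewrite ?Ei ?Ej.
- by move: nL; rewrite neq_ltn => /orP[h|h]; [right|left]; apply: main; rewrite ?Ei ?Ej ?h ?orbT.
Qed.

Local Open Scope ring_scope.
Let S j : R := (partition_start j)%:R.

Lemma partition_start_feasible : feasible S.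
Proof.
split=> [j|i j x ij]; first by rewrite ler0n.
rewrite !in_itv /= => /andP[h1 h2]; apply/negP => /andP[h3 h4].
case: (partition_start_disjoint ij); rewrite -(ler_nat R) natrD -/(S _) -/(S _) => h; lra.
Qed.

Lemma partition_start_cost :
  cost S = (partition_cost p (@wE I) (@wL I) (fun i j => posE i < posE j)%N
              (fun i j => posL i < posL j)%N E)%:R.
Proof.
rewrite /cost /partition_cost natr_sum; apply: eq_bigr => j _.
have -> : S j + (p j)%:R = (partition_start j + p j)%:R by rewrite natrD.
case: (boolP (E j)) => Ej.
  rewrite early_end // natrB ?early_le // (max_idPl _); last first.
    by rewrite subr_ge0 lerBlDr lerDl ler0n.
  rewrite (max_idPr _); last by rewrite subr_le0 lerBlDr lerDl ler0n.
  rewrite mulr0 addr0 opprB addrC subrK -natrM big_distrr /=.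
  by congr (_%:R); rewrite big_mkcond; apply: eq_bigr => i _; rewrite addn0.
rewrite late_end // natrD (max_idPr _); last by rewrite subr_le0 lerDl ler0n.
rewrite (max_idPl _); last by rewrite subr_ge0 lerDl ler0n.
rewrite mulr0 add0r addrC addKr -natrM big_distrr /=.
congr (_%:R); rewrite big_mkcond; apply: eq_bigr => i _; rewrite add0n.
by rewrite leq_eqVlt (inj_eq posL_inj) orbC.
Qed.

End PartitionSchedule.

Section Optimum.
Variables (R : realType) (I : awet) (posE posL : 'I_(njobs I) -> nat).
Hypotheses (posE_inj : injective posE) (posL_inj : injective posL).
Hypothesis posE_ratio : forall i j, posE i < posE j -> wE i * ptime j <= wE j * ptime i.
Hypothesis posL_ratio : forall i j, posL i < posL j -> wL i * ptime j <= wL j * ptime i.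

Definition ordered_cost (E : pred 'I_(njobs I)) :=
  partition_cost (@ptime I) (@wE I) (@wL I) (fun i j => posE i < posE j)
              (fun i j => posL i < posL j) E.

(** Any schedule costs at least a convex combination of two partition costs in its own order, and by
    exchange each of them is at least the minimum in the order by ratios. *)
Lemma optimum_exists : exists2 E0 : pred 'I_(njobs I),
  (forall E, ordered_cost E0 <= ordered_cost E) & is_OPT I ((ordered_cost E0)%:R : R)%R.
Proof.
have eqc E E' : E =1 E' -> ordered_cost E = ordered_cost E'.
  by move=> EE; apply: eq_bigr => i _; apply: eq_bigr => j _; rewrite !EE.
pose F (E : {ffun 'I_(njobs I) -> bool}) := ordered_cost E.
have [E0 _ E0min] := @arg_minnP _ [ffun=> true] xpredT F isT.
have min E : ordered_cost E0 <= ordered_cost E.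
  have := E0min [ffun j => E j] isT; rewrite /F (eqc [ffun j => E j] E) // => j.
  by rewrite ffunE.
exists E0 => //; split.
  exists (fun j => (partition_start E0 posE posL j)%:R%R).
    exact: partition_start_feasible.
  exact: partition_start_cost.
move=> S fS; have [th /andP[th0 th1] h] := cost_lower_bound fS.
apply: le_trans h.
have total i j : i != j -> (S i < S j)%R || (S j < S i)%R.
  move=> ij; have := ptime_gt0 i; have := ptime_gt0 j; rewrite -!(ltr_nat R) => pj pi.
  by case: (feasible_disjoint fS ij) => hh; apply/orP; [left|right]; lra.
have le (E : pred 'I_(njobs I)) : ((ordered_cost E0)%:R <=
  (partition_cost (@ptime I) (@wE I) (@wL I) (fun i j => S i < S j) (fun i j => S j < S i) E)%:R :> R)%R.
  rewrite ler_nat; apply: leq_trans (min E) _; apply: partition_cost_le.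
  - by move=> i j ij; split; [rewrite -leqNgt ltnW|apply: posE_ratio].
  - by move=> i j ij; split; [rewrite -leqNgt ltnW|apply: posL_ratio].
  - exact: total.
  - by move=> i j ij; rewrite orbC total.
  - by move=> i; rewrite /= ltxx.
have := le (fun j => S j + (ptime j)%:R <= (due_date I)%:R)%R.
have := le (fun j => S j < (due_date I)%:R)%R.
by nra.
Qed.

End Optimum.

(** * Instances as lists of items *)

Section Listing.
Variables (n : nat) (lt : rel 'I_n).

Lemma listing_perm : perm_eq (listing lt) (enum 'I_n).
Proof. by rewrite perm_sort. Qed.

Lemma listing_uniq : uniq (listing lt).
Proof. by rewrite (perm_uniq listing_perm) enum_uniq. Qed.

Lemma mem_listing i : i \in listing lt.
Proof. by rewrite (perm_mem listing_perm) mem_enum. Qed.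

Lemma size_listing : size (listing lt) = n.
Proof. by rewrite (perm_size listing_perm) size_enum_ord. Qed.

Lemma index_listing_inj : injective (index^~ (listing lt)).
Proof.
move=> i j /= e; rewrite -(nth_index i (mem_listing i)) e.
exact: nth_index (mem_listing j).
Qed.

Hypothesis lt_total : strict_total_order lt.

Lemma listing_index i j : index i (listing lt) < index j (listing lt) -> lt i j.
Proof.
case: lt_total => irr tr tot h.
have : (i == j) || lt i j.
  apply: (@sorted_ltn_index _ (fun i j => (i == j) || lt i j)) h; rewrite ?mem_listing //.
    move=> y x z /orP[/eqP->//|xy] /orP[/eqP<-|yz]; first by rewrite xy orbT.
    by rewrite (tr y x z xy yz) orbT.
  apply: sort_sorted => x y; have [->//|xy] := eqVneq x y.
  by case/orP: (tot x y xy) => ->; rewrite !orbT.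
by case/orP => // /eqP ij; rewrite ij ltnn in h.
Qed.

End Listing.

Lemma map_index_uniq (T : eqType) (s : seq T) : uniq s ->
  [seq index x s | x <- s] = iota 0 (size s).
Proof.
move=> us; case: s us => // x0 s us; apply: (@eq_from_nth _ 0); first by rewrite size_map size_iota.
move=> i; rewrite size_map => hi.
by rewrite (nth_map x0) // index_uniq // nth_iota.
Qed.

(** Ties may be broken either way: a strictly larger ratio of [i] would force [lt j i], against the
    order of the listing. *)
Lemma ratio_monotone n (lt : rel 'I_n) (w p : 'I_n -> nat) :
  strict_total_order lt -> (forall j, 0 < p j) ->
  (forall i j, ((w i)%:R / (p i)%:R < (w j)%:R / (p j)%:R :> rat)%R -> lt i j) ->
  forall i j, index i (listing lt) < index j (listing lt) -> w i * p j <= w j * p i.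
Proof.
move=> tot p0 h i j /(listing_index tot) ij; rewrite leqNgt; apply/negP => wij.
have [irr tr _] := tot; have : lt j i.
  apply: h; rewrite ltr_pdivrMr ?ltr0n // mulrAC ltr_pdivlMr ?ltr0n //.
  by rewrite -!natrM ltr_nat.
by move=> ji; have := tr _ _ _ ij ji; rewrite irr.
Qed.

(** It recovers the partition from a list: since the items are distinct, membership of [(a, true)]
    decides the mark of [a]. *)
Lemma marking_of_unzip1 (T : eqType) (t : seq (T * bool)) : uniq (unzip1 t) ->
  t = [seq (a, (a, true) \in t) | a <- unzip1 t].
Proof.
move=> u; rewrite -map_comp -[LHS]map_id; apply/eq_in_map => -[a c] at_ /=.
congr pair; case: c at_ => [->//|af]; apply/esym/negP => at_.
elim: t u af at_ => //= -[b c] t IH /= /andP[bt u].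
rewrite !inE => /predU1P[[ab cf]|af] /predU1P[[ab' ct]|at_].
- by rewrite -ct in cf.
- by move: bt; rewrite -ab (map_f fst at_).
- by move: bt; rewrite -ab' (map_f fst af).
- exact: IH.
Qed.

Section Encoding.
Variables (I : awet) (ltE ltL : rel 'I_(njobs I)) (eps : rat).

Definition raw : raw_input :=
  ((`|numq eps|%N, `|denq eps|%N),
   ([seq (ptime j, (wE j, wL j)) | j <- enum 'I_(njobs I)],
    ([seq val j | j <- listing ltE], [seq val j | j <- listing ltL]))).

Lemma enc_raw : enc raw = enc_input ltE ltL eps.
Proof. by rewrite /enc_input /enc_jobs /enc_order /enc_rat /= -!map_comp. Qed.

Definition posE (j : 'I_(njobs I)) := index j (listing ltE).
Definition posL (j : 'I_(njobs I)) := (index j (listing ltL)).+1.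

Lemma posE_inj : injective posE.
Proof. exact: index_listing_inj. Qed.

Lemma posL_inj : injective posL.
Proof. by move=> i j [] /index_listing_inj. Qed.

Definition item_of (j : 'I_(njobs I)) : item :=
  (val j, ptime j, wE j, wL j, posE j, posL j).

Lemma item_of_inj : injective item_of.
Proof. by move=> i j [] /val_inj. Qed.

Lemma mk_items_raw : mk_items raw = [seq item_of j | j <- listing ltE].
Proof.
rewrite /mk_items /= -map_comp; apply: eq_map => j /=.
rewrite /mk_item (nth_map j) ?size_enum_ord // nth_ord_enum /=.
by rewrite /item_of /posE /posL !index_map //; exact: val_inj.
Qed.

Lemma items_posE : sorted ltn (map it_posE (mk_items raw)).
Proof.
rewrite mk_items_raw -map_comp (eq_map (g := index^~ (listing ltE))) //.
by rewrite map_index_uniq ?listing_uniq // iota_ltn_sorted.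
Qed.

Lemma items_posL : map it_posL (mk_items raw) = ratio_perm ltE ltL.
Proof. by rewrite mk_items_raw -map_comp. Qed.

Lemma items_posL_uniq : uniq (map it_posL (mk_items raw)).
Proof.
rewrite mk_items_raw -map_comp map_inj_uniq ?listing_uniq //.
exact: posL_inj.
Qed.

Definition marked (E : pred 'I_(njobs I)) : state :=
  [seq (item_of j, E j) | j <- listing ltE].

Lemma marked_unzip1 E : unzip1 (marked E) = mk_items raw.
Proof. by rewrite mk_items_raw /unzip1 -map_comp. Qed.

Lemma sum_marked E (P : pred (item * bool)) (F : item * bool -> nat) :
  \sum_(a <- marked E | P a) F a = \sum_(j | P (item_of j, E j)) F (item_of j, E j).
Proof. by rewrite big_map (perm_big _ (listing_perm ltE)) big_enum_cond. Qed.

Lemma st_cost_marked E : st_cost (marked E) = ordered_cost posE posL E.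
Proof.
rewrite /st_cost sum_marked; apply: eq_bigr => i _; rewrite sum_marked.
apply: eq_bigr => j _; rewrite /pair_cost /=.
rewrite /it_posE /it_posL /it_wE /it_wL /it_p /=.
by rewrite [posL i <= _]leq_eqVlt (inj_eq posL_inj) orbC.
Qed.

Lemma start_marked E j : start (marked E) (val j) = partition_start E posE posL j.
Proof.
rewrite /start sum_marked (big_pred1 j); last by move=> i; rewrite /it_id /= val_eqE.
rewrite !sum_marked /partition_start /=.
by rewrite (eq_bigl xpredT).
Qed.

Lemma marked_of_unzip1 (t : state) : unzip1 t = mk_items raw ->
  exists E, t = marked E.
Proof.
move=> tW; exists (fun j => (item_of j, true) \in t).
rewrite {1}[t]marking_of_unzip1 tW mk_items_raw -?map_comp //.
by rewrite map_inj_uniq ?listing_uniq //; exact: item_of_inj.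
Qed.

Lemma enc_solve m E : solution m raw = marked E ->
  enc (solve (m, raw)) =
  enc_schedule (fun j => (partition_start E posE posL j)%:R : rat)%R.
Proof.
move=> sE; rewrite /enc_schedule /solve /= sE size_map size_enum_ord.
rewrite -val_enum_ord -!map_comp; congr enc_seq; apply: eq_map => j /=.
rewrite start_marked /enc_rat; move: (partition_start _ _ _ _) => k.
by rewrite pmulrn numq_int denq_int.
Qed.

Lemma size_mk_items : size (mk_items raw) = njobs I.
Proof. by rewrite mk_items_raw size_map size_listing. Qed.

End Encoding.

(** * Choice of the precision *)

Section Precision.
Local Open Scope ring_scope.

(** A converse to Bernoulli's inequality. With y = N x the step is (1 + x)(1 + 2y) <= 1 + 2(x + y),
    where 2xy <= x because y <= 1/2. *)
Lemma expr1D_le (R : realFieldType) (x : R) N : 0 <= x -> N%:R * x <= 2^-1 ->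
  (1 + x) ^+ N <= 1 + 2 * (N%:R * x).
Proof.
move=> x0; elim: N => [|N IH]; first by rewrite expr0 mul0r mulr0 addr0.
rewrite exprS -natr1 => h.
have N0 : 0 <= N%:R * x by rewrite mulr_ge0 // ler0n.
have := IH _; rewrite mulrDl mul1r in h *.
move: (N%:R * x) N0 h => y y0 h /(_ ltac:(lra)) hy.
apply: le_trans (ler_wpM2l _ hy) _; first by lra.
by nra.
Qed.

Lemma growth_le (R : realFieldType) n m : (0 < n)%N -> (0 < m)%N ->
  growth R (4 * n * m) ^+ (2 * n) <= 1 + m%:R^-1.
Proof.
move=> n0 m0; rewrite /growth.
have nR : 0 < n%:R :> R by rewrite ltr0n.
have mR : 0 < m%:R :> R by rewrite ltr0n.
have m1 : m%:R^-1 <= 1 :> R by rewrite invf_le1 // ler1n.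
(* For K = 4nm the exponent 2n gives 2n/K = 1/(2m), at most 1/2 as required; its double is 1/m. *)
have E : (2 * n)%N%:R * (4 * n * m)%N%:R^-1 = m%:R^-1 / 2 :> R.
  by rewrite !natrM; field; rewrite !gt_eqF.
apply: le_trans (expr1D_le _ _) _.
- by rewrite invr_ge0 ler0n.
- by rewrite E; lra.
by rewrite E; lra.
Qed.

Variable eps : rat.
Hypothesis eps_gt0 : 0 < eps.

Let num : nat := `|numq eps|%N.
Let den : nat := `|denq eps|%N.

Let epsE (F : numFieldType) : ratr eps = num%:R / den%:R :> F.
Proof.
rewrite /ratr /num /den; congr (_ / _).
  by rewrite -[in LHS](gez0_abs (m := numq eps)) ?numq_ge0 1?ltW.
by rewrite -[in LHS](gez0_abs (m := denq eps)) ?denq_ge0.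
Qed.

Let num_gt0 : (0 < num)%N.
Proof. by rewrite /num absz_gt0 numq_eq0 gt_eqF. Qed.

Let den_gt0 : (0 < den)%N.
Proof. by rewrite /den absz_gt0 denq_neq0. Qed.

Lemma unary_size_inv (R : numFieldType) : ((den %/ num + 1)%N%:R)^-1 <= ratr eps :> R.
Proof.
rewrite epsE -[leRHS]invrK lef_pV2 ?posrE ?invr_gt0 ?divr_gt0 ?ltr0n ?addn1 // invf_div.
rewrite ler_pdivrMr ?ltr0n // -natrM ler_nat ltnW //.
exact: ltn_ceil.
Qed.

Lemma unary_size_le : (den %/ num + 1)%N%:R <= eps^-1 + 1 :> rat.
Proof.
have -> : eps = num%:R / den%:R by rewrite -epsE /ratr divq_num_den.
rewrite natrD lerD2r invf_div ler_pdivlMr ?ltr0n // -natrM ler_nat.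
exact: leq_trunc_div.
Qed.

End Precision.

(** * The approximation scheme *)

Local Open Scope ring_scope.

Theorem mainTheorem5 :
  exists (A : prog) (P : {poly {poly rat}}),
  forall (R : realType) (I : awet) (ltE ltL : rel 'I_(njobs I)),
    strict_total_order ltE ->
    strict_total_order ltL ->
    (forall i j, early_ratio i < early_ratio j -> ltE i j) ->
    (forall i j, tardy_ratio i < tardy_ratio j -> ltL i j) ->
    separable (ratio_perm ltE ltL) ->
    forall eps : rat, 0 < eps ->
    exists (S : 'I_(njobs I) -> rat) (t : nat) (opt : R),
      let x := enc_input ltE ltL eps in
      let SR : 'I_(njobs I) -> R := fun j => ratr (S j) in
      [/\ exec A x (enc_schedule S) t,
          t%:R <= P.[((value_len x)%:R)%:P].[eps^-1],
          feasible SR,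
          is_OPT I opt
        & cost SR <= (1 + ratr eps) * opt].
Proof.
have [A [c hA]] := solve_program.
(* The outer variable stands for the input length, the inner one for the inverse tolerance. The 2
   collects the successor in the time bound and the 1 by which the unary precision may exceed that
   inverse. *)
exists A, (('X + ('X)%:P + 2%:P%:P) ^+ c).
move=> R I ltE ltL totE totL hE hL sep eps eps0.
pose x := raw ltE ltL eps; pose m := unary_size x.
pose W := mk_items x.
have WI : size W = njobs I by exact: size_mk_items.
have m0 : (0 < m)%N by rewrite /m /unary_size addn1.
have n0 : (0 < njobs I)%N := njobs_gt0 I.
pose K := scale (nseq m 0) W.
have KE : K = (4 * njobs I * m)%N by rewrite /K /scale WI size_nseq.
have K0 : (0 < K)%N by rewrite KE !muln_gt0 n0 m0.
have sepW : separable (map it_posL W) by rewrite /W items_posL.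
have [tW tbest] := @solution_near R K K0 W (items_posE _ _ _) (items_posL_uniq _ _ _)
  (nseq m 0) erefl sepW.
have [E tE] := marked_of_unzip1 tW.
have ratE := @ratio_monotone _ _ (@wE I) _ totE (@ptime_gt0 I) hE.
have ratL i j : (posL ltL i < posL ltL j -> wL i * ptime j <= wL j * ptime i)%N.
  exact: (@ratio_monotone _ _ (@wL I) _ totL (@ptime_gt0 I) hL).
have [E0 E0min opt] := optimum_exists R (@posE_inj I ltE) (@posL_inj I ltL) ratE ratL.
have [t et lt] := hA x.
exists (fun j => (partition_start E (posE ltE) (posL ltL) j)%:R), t.
exists (ordered_cost (posE ltE) (posL ltL) E0)%:R; split=> //.
- rewrite -(@enc_solve _ _ _ eps (nseq m 0)); last exact: tE.
  by rewrite -enc_raw.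
- rewrite -enc_raw -/(len x) !(horner_exp, hornerD, hornerX, hornerC).
  apply: le_trans (_ : ((len x + m).+1 ^ c)%N%:R <= _); first by rewrite ler_nat.
  rewrite natrX; have := unary_size_le eps0; rewrite -/(unary_size x) -/m => hm.
  have e0 : 0 <= eps^-1 by rewrite invr_ge0 ltW.
  have l0 : 0 <= (len x)%:R :> rat by rewrite ler0n.
  apply: lerXn2r; rewrite ?nnegrE ?ler0n //; first by lra.
  by rewrite -natr1 natrD; lra.
- have [h1 h2] := partition_start_feasible R E (@posE_inj I ltE) (@posL_inj I ltL).
  by split=> [j|i j y ij]; rewrite !ratr_nat; [exact: h1|apply: h2].
have -> : cost (fun j => ratr ((partition_start E (posE ltE) (posL ltL) j)%:R : rat) : R) =
    cost (fun j => (partition_start E (posE ltE) (posL ltL) j)%:R).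
  by apply: eq_bigr => j _; rewrite ratr_nat.
rewrite (partition_start_cost R E (@posE_inj I ltE) (@posL_inj I ltL)).
(* The returned state is compared with the marking of an optimal partition. *)
have := tbest (marked ltE ltL E0) (marked_unzip1 _ _ _ _).
rewrite tE !st_cost_marked => /le_trans; apply.
rewrite ler_wpM2r ?ler0n // WI KE; apply: le_trans (growth_le _ n0 m0) _.
by rewrite lerD2l; apply: unary_size_inv.
Qed.
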